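(* Let $T\ge 1$ be an integer, $\delta\in(0,1)$, assume $\Delta(K_0)>0$ and let $\Delta=4\Delta(K_0)$. Suppose the stochastic gradient oracle satisfies the Noise Condition stated in the context, and that $G_\Delta\big(b+\sqrt{V_\Delta\delta}\big)/\mu\le \Delta(K_0)$. Denote $$N=\left\lceil\max\left\{4,\ \frac{2M_{\Delta,\delta}}{\mu r_\Delta},\ \frac{1024\,G_\Delta^2(M_{\Delta,\delta}+G_\Delta)^2\log(1/\delta)}{\mu^2\Delta(K_0)^2},\ \frac{8L_\Delta M_{\Delta,\delta}^2}{\mu^2\Delta(K_0)}\right\}\right\rceil,\qquad C=3\Delta(K_0)\sqrt N .$$ Run the stochastic policy gradient method with stepsizes $\eta_t=\frac{2}{\mu(N+t)}$. Then with probability at least $1-2T\delta$, $$\Delta(K_t)\le \frac{G_\Delta\big(b+\sqrt{V_\Delta\delta}\big)}{\mu}+\frac{C}{\sqrt{N+t}}\qquad\text{for all } 0\le t\le T .$$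
   Context: LQR problem. Let $A\in\mathbb{R}^{n\times n}$, $B\in\mathbb{R}^{n\times m}$, let $Q\in\mathbb{R}^{n\times n}$, $R\in\mathbb{R}^{m\times m}$ be symmetric positive definite, and let $\mathcal{D}$ be a distribution on $\mathbb{R}^n$ with $\mathbb{E}_{x_0\sim\mathcal{D}}[x_0x_0^\top]=I_n$ and $\|x_0\|\le D_X$ for some $D_X>0$. For a policy $K\in\mathbb{R}^{m\times n}$ let $f(K)=\mathbb{E}_{x_0\sim\mathcal{D}}\big[\sum_{i\ge0}(x_i^\top Qx_i+a_i^\top Ra_i)\big]\in[0,+\infty]$, where $x_{i+1}=Ax_i+Ba_i$, $a_i=-Kx_i$. Let $f^*=\min_K f(K)$, assumed finite, and $\Delta(K)=f(K)-f^*$. A policy $K$ is stable if $\rho(A-BK)<1$ ($\rho$ is the spectral radius); this is equivalent to $\Delta(K)<\infty$. $\|\cdot\|$ is the Euclidean norm of vectors and the Frobenius norm of matrices, $\langle\cdot,\cdot\rangle$ the associated inner product. Stochastic policy gradient (SPG). From a fixed stable $K_0$, iterate $K_{t+1}=K_t-\eta_tG_t$, $t\ge0$, where $G_t$ is a stochastic estimate of $\nabla f(K_t)$. $\mathcal{F}_t$ is the filtration up to iteration $t$, excluding $t$ (so $K_t$ is $\mathcal{F}_t$-measurable and $G_t$ is $\mathcal{F}_{t+1}$-measurable). Noise Condition. For any $\Delta>0$ and $\delta\in(0,1)$ there exist $b\ge0$, $V_\Delta>0$, $M_{\Delta,\delta}>0$ such that, for any $K_t$ with $\Delta(K_t)\le\Delta$: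 (i) $\|\mathbb{E}[G_t|\mathcal{F}_t]-\nabla f(K_t)\|\le b$; (ii) $\mathbb{E}[\|G_t\|^2|\mathcal{F}_t]\le V_\Delta$; (iii) $\mathbb{P}(\|G_t\|\le M_{\Delta,\delta}\,|\,\mathcal{F}_t)\ge1-\delta$. Landscape constants. $\mu>0$ (independent of $\Delta$) and, for each $\Delta>0$, $L_\Delta,r_\Delta>0$ are fixed constants such that for every policy $K$ with $\Delta(K)<\Delta$: every $K'$ with $\|K'-K\|\le r_\Delta$ is stable and satisfies $f(K')\le f(K)+\langle\nabla f(K),K'-K\rangle+\frac{L_\Delta}{2}\|K-K'\|^2$; and $\mu\Delta(K)\le\|\nabla f(K)\|^2\le2L_\Delta\Delta(K)$. (Such constants are known to exist for LQR.) Also $G_\Delta=2\sqrt{L_\Delta\Delta}$. *)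

(* Defs.v *)
From HB Require Import structures.
From mathcomp Require Import all_boot all_order all_algebra.
From mathcomp Require Import complex.
From mathcomp Require Import all_classical all_reals all_analysis.
From mathcomp Require Import measurable_realfun.
Set Implicit Arguments.
Unset Strict Implicit.
Unset Printing Implicit Defensive.
Import Order.TTheory GRing.Theory Num.Theory numFieldNormedType.Exports.
Local Open Scope classical_set_scope.
Local Open Scope ring_scope.

Section Matrices.
Variable R : realType.

(* The library norm on matrices is the sup norm, hence these definitions. On
   column vectors they are the Euclidean inner product and norm. *)
Definition frob_inner m n (X Y : 'M[R]_(m, n)) : R := \tr (X^T *m Y).

Definition frob_norm m n (X : 'M[R]_(m, n)) : R := Num.sqrt (frob_inner X X).

Definition quad_form n (Q : 'M[R]_n) (x : 'cV[R]_n) : R :=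
  (x^T *m Q *m x) 0 0.

Definition sym_posdef n (Q : 'M[R]_n) : Prop :=
  Q^T = Q /\ forall x : 'cV[R]_n, x != 0 -> 0 < quad_form Q x.

(* The modulus of l is `|l|, which lies in R[i] with zero imaginary part. *)
Definition spectral_radius n (X : 'M[R]_n) : R :=
  sup [set complex.Re `|l| | l in
        [set l : R[i] | eigenvalue (map_mx (real_complex R) X) l]].

End Matrices.

Section LQR.
Variables (R : realType) (n m : nat).
Variables (A : 'M[R]_n) (B : 'M[R]_(n, m)) (Q : 'M[R]_n) (S : 'M[R]_m).

Definition borel_cV := g_sigma_algebraType (@open 'cV[R]_n).

Definition lqr_action (K : 'M[R]_(m, n)) (x : 'cV[R]_n) : 'cV[R]_m :=
  - (K *m x).

Fixpoint lqr_state (K : 'M[R]_(m, n)) (x0 : 'cV[R]_n) (i : nat) : 'cV[R]_n :=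
  if i is j.+1 then
    A *m lqr_state K x0 j + B *m lqr_action K (lqr_state K x0 j)
  else x0.

Definition lqr_stage_cost (K : 'M[R]_(m, n)) (x : 'cV[R]_n) : R :=
  quad_form Q x + quad_form S (lqr_action K x).

Definition lqr_cost (D : probability borel_cV R) (K : 'M[R]_(m, n)) : \bar R :=
  (\int[D]_x \sum_(0 <= i <oo) (lqr_stage_cost K (lqr_state K x i))%:E)%E.

Definition stable (K : 'M[R]_(m, n)) : Prop := spectral_radius (A - B *m K) < 1.

End LQR.

Definition initial_distribution (R : realType) (n : nat)
    (D : probability (borel_cV R n) R) (DX : R) : Prop :=
  (forall i j : 'I_n,
     (\int[D]_x (x i 0 * x j 0)%:E = ((i == j)%:R)%:E)%E) /\
  {ae D, forall x : 'cV[R]_n, frob_norm x <= DX}.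

Section Objective.
Variables (R : realType) (n m : nat).
Variable f : 'M[R]_(m, n) -> \bar R.

Definition is_minimum (fstar : R) : Prop :=
  (exists K, f K = fstar%:E) /\ (forall K, (fstar%:E <= f K)%E).

Definition gap (fstar : R) (K : 'M[R]_(m, n)) : \bar R := (f K - fstar%:E)%E.

(* The matrix of partial derivatives; it is only used at policies of finite
   cost, where fine does not lose information. *)
Definition grad (K : 'M[R]_(m, n)) : 'M[R]_(m, n) :=
  \matrix_(i, j) 'D_(delta_mx i j) (fun X : 'M[R]_(m, n) => fine (f X)) K.

Definition landscape_constants (stab : 'M[R]_(m, n) -> Prop) (fstar : R)
    (mu : R) (L r : R -> R) : Prop :=
  0 < mu /\
  forall Dl : R, 0 < Dl ->
    [/\ 0 < L Dl, 0 < r Dl &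
     forall K, (gap fstar K < Dl%:E)%E ->
       [/\ forall K', frob_norm (K' - K) <= r Dl ->
             stab K' /\
             (f K' <= f K + (frob_inner (grad K) (K' - K)
                             + L Dl / 2 * frob_norm (K - K') ^+ 2)%:E)%E,
           (mu%:E * gap fstar K <= (frob_norm (grad K) ^+ 2)%:E)%E &
           ((frob_norm (grad K) ^+ 2)%:E <= (2 * L Dl)%:E * gap fstar K)%E]].

End Objective.

Section Conditioning.
Context d (W : measurableType d) (R : realType).
Variable P : probability W R.

Definition filtration (F : nat -> set (set W)) : Prop :=
  [/\ forall t, sigma_algebra [set: W] (F t),
      forall t, F t `<=` @measurable d W &
      forall t, F t `<=` F t.+1].

Definition measurable_wrt (H : set (set W)) d' (V : measurableType d')
    (X : W -> V) : Prop :=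
  @measurable_fun _ _ (g_sigma_algebraType H) V setT X.

Definition measurable_mx_wrt (H : set (set W)) m n (X : W -> 'M[R]_(m, n)) :
    Prop :=
  forall i j, measurable_wrt H (fun w => X w i j).

(* Y is a version of E[X | H], for X with values in [0, +oo]. *)
Definition condexp_ge0 (H : set (set W)) (X Y : W -> \bar R) : Prop :=
  [/\ measurable_wrt H Y,
      forall w, (0 <= Y w)%E &
      forall E, H E -> (\int[P]_(w in E) Y w = \int[P]_(w in E) X w)%E].

(* Y is a version of E[X | H] = E[X^+ | H] - E[X^- | H]. Integrability of X is
   not required: the value is meaningful wherever E[|X| | H] is finite. *)
Definition condexp (H : set (set W)) (X : W -> R) (Y : W -> \bar R) : Prop :=
  exists Yp Yn : W -> \bar R,
    [/\ condexp_ge0 H ((EFin \o X)^\+)%E Yp,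
        condexp_ge0 H ((EFin \o X)^\-)%E Yn &
        forall w, (Y w = Yp w - Yn w)%E].

End Conditioning.

(* A fixed-time bound on conditional expectations given F t is understood
   almost surely on the event {gap (K t) <= Dl}. The iterates may leave this
   event, so G t need not be integrable; on it, the second moment bound makes
   E[G t | F t] finite, so that fine below is harmless. *)
Definition noise_condition d (W : measurableType d) (R : realType)
    (P : probability W R) (n m : nat) (f : 'M[R]_(m, n) -> \bar R) (fstar : R)
    (F : nat -> set (set W)) (K G : nat -> W -> 'M[R]_(m, n))
    (b : R -> R -> R) (V : R -> R) (M : R -> R -> R) : Prop :=
  forall Dl dl : R, 0 < Dl -> 0 < dl < 1 ->
  [/\ 0 <= b Dl dl, 0 < V Dl, 0 < M Dl dl &
   forall t : nat,
   [/\ exists2 Y : 'I_m -> 'I_n -> W -> \bar R,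
         forall i j, condexp P (F t) (fun w => G t w i j) (Y i j) &
         {ae P, forall w, (gap f fstar (K t w) <= Dl%:E)%E ->
            frob_norm (\matrix_(i, j) fine (Y i j w) - grad f (K t w))
            <= b Dl dl},
       exists2 Y : W -> \bar R,
         condexp_ge0 P (F t) (fun w => (frob_norm (G t w) ^+ 2)%:E) Y &
         {ae P, forall w, (gap f fstar (K t w) <= Dl%:E)%E ->
            (Y w <= (V Dl)%:E)%E} &
       exists2 Y : W -> \bar R,
         condexp_ge0 P (F t)
           (fun w => (\1_[set v | frob_norm (G t v) <= M Dl dl] w)%:E) Y &
         {ae P, forall w, (gap f fstar (K t w) <= Dl%:E)%E ->
            ((1 - dl)%:E <= Y w)%E}]].

Fixpoint spg_iterates (W : Type) (R : realType) (n m : nat)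
    (K0 : 'M[R]_(m, n)) (eta : nat -> R) (G : nat -> W -> 'M[R]_(m, n))
    (t : nat) (w : W) : 'M[R]_(m, n) :=
  if t is s.+1 then spg_iterates K0 eta G s w - eta s *: G s w else K0.

(* Main.v *)
Require Import Defs.
From HB Require Import structures.
From mathcomp Require Import all_boot all_order all_algebra.
From mathcomp Require Import all_classical all_reals all_analysis.
From mathcomp Require Import measurable_realfun.
From mathcomp Require Import complex.
From mathcomp Require Import ring lra.
Set Implicit Arguments.
Unset Strict Implicit.
Unset Printing Implicit Defensive.
Import Order.TTheory GRing.Theory Num.Theory numFieldNormedType.Exports.
Local Open Scope classical_set_scope.
Local Open Scope ring_scope.

(**
With g = grad f (K_t), beta = b + sqrt (V delta) and G_t truncated at norm
M, conditioning on F_t makes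

  - <g, trunc G_t> + |g|^2 - beta |g|

a bounded increment of non-positive conditional mean as long as the gap of K_t
is at most 3 Delta0: the bias of the truncation is at most sqrt (V delta) by
AM-GM (instead of Cauchy-Schwarz). Smoothness and gradient domination turn the
increments into the recursion

  D_{t+1} <= (1 - 2/(N+t)) D_t + 2/(mu (N+t)) (GD beta + increment) +
    O(1/(N+t)^2),

which telescopes after multiplication by (N+t)(N+t-1), leaving the weighted sum
of the increments. An Azuma inequality bounds that sum at each time, and a union
bound over the T truncation events and the T Azuma events costs 2 T delta; off
these events the gap stays below 3 Delta0 by induction on t.

The iterates are random, so f and grad f must be measurable along them: f by
Tonelli, and the partial derivatives as limits of difference quotients, their
existence being itself a measurable condition thanks to the quadratic upper
model of f. Finiteness of f at a stable policy follows from Cayley-Hamilton. *)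

(** * Frobenius inner product *)

(** The norm of [G_t] is bounded only with high probability, which gives no bounded differences for
    Azuma; truncation supplies them at the price of a bias. The landscape and noise bounds hold only
    at low gap, and the iterates may leave that region. Instead of a stopping time, the gradient is
    multiplied by the indicator of the [F_t]-measurable event [gap <= 3 Delta0]: the increments then
    have non-positive conditional mean at every time, and mask and truncation are inactive on a path
    until a bad event occurs. The level stays below [Delta = 4 Delta0] because the landscape
    constants ask for a strict inequality, and the induction closes by [q + 2 Delta0 <= 3 Delta0].

    [G_t] may fail to be integrable, so conditional means are only ever used through integrals
    against non-negative [F_t]-measurable weights, vanishing where no bound is available.

    The rate comes out with [2 Delta0]: the initial gap contributes [1], the noise [2/11], the
    curvature [1/2]. Azuma has the denominator [8] instead of [2], since an elementary exponential
    inequality replaces Hoeffding's lemma; [8 * 11^2 = 968] still fits below [1024]. *)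

Section Frobenius.
Context {R : realType} {m n : nat}.
Implicit Types X Y Z : 'M[R]_(m, n).

Lemma frob_innerE X Y : frob_inner X Y = \sum_i \sum_j X i j * Y i j.
Proof.
rewrite /frob_inner /mxtrace exchange_big /=; apply: eq_bigr => j _.
by rewrite mxE; apply: eq_bigr => i _; rewrite mxE.
Qed.

Lemma frob_innerC X Y : frob_inner X Y = frob_inner Y X.
Proof.
rewrite !frob_innerE; apply: eq_bigr => i _; apply: eq_bigr => j _.
exact: mulrC.
Qed.

Lemma frob_innerDr X Y Z :
  frob_inner X (Y + Z) = frob_inner X Y + frob_inner X Z.
Proof. by rewrite /frob_inner mulmxDr linearD. Qed.

Lemma frob_innerZr a X Y : frob_inner X (a *: Y) = a * frob_inner X Y.
Proof. by rewrite /frob_inner -scalemxAr linearZ. Qed.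

Lemma frob_innerDl X Y Z :
  frob_inner (X + Y) Z = frob_inner X Z + frob_inner Y Z.
Proof. by rewrite frob_innerC frob_innerDr !(frob_innerC Z). Qed.

Lemma frob_innerZl a X Y : frob_inner (a *: X) Y = a * frob_inner X Y.
Proof. by rewrite frob_innerC frob_innerZr frob_innerC. Qed.

Lemma frob_inner_ge0 X : 0 <= frob_inner X X.
Proof.
rewrite frob_innerE; apply: sumr_ge0 => i _; apply: sumr_ge0 => j _.
by rewrite -expr2 sqr_ge0.
Qed.

Lemma frob_norm_ge0 X : 0 <= frob_norm X.
Proof. exact: sqrtr_ge0. Qed.

Lemma frob_norm_sqr X : frob_norm X ^+ 2 = frob_inner X X.
Proof. by rewrite sqr_sqrtr// frob_inner_ge0. Qed.

Lemma frob_normZ a X : frob_norm (a *: X) = `|a| * frob_norm X.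
Proof.
by rewrite /frob_norm frob_innerZr frob_innerZl mulrA -expr2 sqrtrM ?sqr_ge0//
  sqrtr_sqr.
Qed.

Lemma frob_normN X : frob_norm (- X) = frob_norm X.
Proof. by rewrite -scaleN1r frob_normZ normrN1 mul1r. Qed.

Lemma frob_normB X Y : frob_norm (X - Y) = frob_norm (Y - X).
Proof. by rewrite -frob_normN opprB. Qed.

(** Cauchy-Schwarz from [|a X - b Y|^2 >= 0] with weights [a = |Y|], [b = |X|]. When one norm
    vanishes these weights are useless, and a large weight on the null matrix contradicts a positive
    inner product instead. *)
Lemma frob_inner_le_norm X Y : frob_inner X Y <= frob_norm X * frob_norm Y.
Proof.
have disc (a b : R) :
    2 * (a * b) * frob_inner X Y <= a ^+ 2 * frob_norm X ^+ 2 + b ^+ 2 *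
      frob_norm Y ^+ 2.
  have := frob_inner_ge0 (a *: X - b *: Y).
  rewrite !frob_norm_sqr -scaleNr frob_innerDr !frob_innerDl.
  rewrite !frob_innerZl !frob_innerZr (frob_innerC Y X).
  by move=> h; rewrite -subr_ge0; apply: le_trans h _; rewrite le_eqVlt;
    apply/orP; left; apply/eqP; ring.
have [x0|x0] := eqVneq (frob_norm X) 0.
  have e : forall a, 0 < a -> 2 * a * frob_inner X Y <= frob_norm Y ^+ 2.
    by move=> a a0; have := disc a 1; rewrite x0; lra.
  rewrite x0 mul0r leNgt; apply/negP => p.
  have := e ((frob_norm Y ^+ 2 + 1) / frob_inner X Y).
  rewrite divr_gt0 // ?ltr_wpDl ?sqr_ge0 // => /(_ isT).
  rewrite -mulrA divfK ?gt_eqF//.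
  have := sqr_ge0 (frob_norm Y); lra.
have [y0|y0] := eqVneq (frob_norm Y) 0.
  have e : forall a, 0 < a -> 2 * a * frob_inner X Y <= frob_norm X ^+ 2.
    by move=> a a0; have := disc 1 a; rewrite y0; lra.
  rewrite y0 mulr0 leNgt; apply/negP => p.
  have := e ((frob_norm X ^+ 2 + 1) / frob_inner X Y).
  rewrite divr_gt0 // ?ltr_wpDl ?sqr_ge0 // => /(_ isT).
  rewrite -mulrA divfK ?gt_eqF//.
  have := sqr_ge0 (frob_norm X); lra.
have xp : 0 < frob_norm X by rewrite lt0r x0 frob_norm_ge0.
have yp : 0 < frob_norm Y by rewrite lt0r y0 frob_norm_ge0.
have h := disc (frob_norm Y) (frob_norm X).
rewrite -(ler_pM2l (_ : 0 < 2 * (frob_norm Y * frob_norm X))); last first.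
  by rewrite !mulr_gt0.
by apply: le_trans h _; rewrite le_eqVlt; apply/orP; left; apply/eqP; ring.
Qed.

Lemma frob_innerNl X Y : frob_inner (- X) Y = - frob_inner X Y.
Proof. by rewrite -scaleN1r frob_innerZl mulN1r. Qed.

Lemma normr_frob_inner_le X Y : `|frob_inner X Y| <= frob_norm X * frob_norm Y.
Proof.
rewrite ler_norml frob_inner_le_norm andbT lerNl -frob_innerNl.
by apply: le_trans (frob_inner_le_norm _ _) _; rewrite frob_normN.
Qed.

Lemma normr_entry_le X i j : `|X i j| <= frob_norm X.
Proof.
rewrite -sqrtr_sqr /frob_norm ler_wsqrtr// frob_innerE (bigD1 i)//= (bigD1
  j)//=.
rewrite -expr2 -addrA lerDl addr_ge0//.
  by apply: sumr_ge0 => k _; rewrite -expr2 sqr_ge0.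
by apply: sumr_ge0 => k _; apply: sumr_ge0 => l _; rewrite -expr2 sqr_ge0.
Qed.

Lemma frob_inner_deltar X i j : frob_inner X (delta_mx i j) = X i j.
Proof.
rewrite frob_innerE (bigD1 i)//= (bigD1 j)//= !mxE !eqxx mulr1.
rewrite big1 => [|k kj]; last by rewrite mxE (negbTE kj) andbF mulr0.
rewrite big1 ?addr0// => k ki; rewrite big1// => l _.
by rewrite mxE (negbTE ki) mulr0.
Qed.

End Frobenius.

(** * Measurability of the cost *)

(** On [T = g_sigma_algebraType H] this is convertible to [measurable_mx_wrt H], so the lemmas below
    serve both the full sigma-algebra and every [F t]. *)
Definition entry_measurable d (T : measurableType d) (R : realType) m n
    (X : T -> 'M[R]_(m, n)) : Prop :=
  forall i j, measurable_fun [set: T] (fun w => X w i j).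

Section EntryMeasurable.
Context {d} {T : measurableType d} {R : realType}.

Lemma entry_measurable_cst m n (X : 'M[R]_(m, n)) :
  entry_measurable (fun _ : T => X).
Proof. by move=> i j; exact: measurable_cst. Qed.

Lemma entry_measurableD m n (X Y : T -> 'M[R]_(m, n)) :
  entry_measurable X -> entry_measurable Y ->
  entry_measurable (fun w => X w + Y w).
Proof.
move=> mX mY i j; rewrite (_ : (fun w => _) = (fun w => X w i j) \+ (fun w => Y
  w i j)).
  exact: measurable_funD.
by apply/funext => w /=; rewrite mxE.
Qed.

Lemma entry_measurableZ m n (a : T -> R) (X : T -> 'M[R]_(m, n)) :
  measurable_fun [set: T] a -> entry_measurable X ->
  entry_measurable (fun w => a w *: X w).
Proof.
move=> ma mX i j; rewrite (_ : (fun w => _) = a \* (fun w => X w i j)).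
  exact: measurable_funM.
by apply/funext => w /=; rewrite mxE.
Qed.

Lemma entry_measurableN m n (X : T -> 'M[R]_(m, n)) :
  entry_measurable X -> entry_measurable (fun w => - X w).
Proof.
move=> mX; rewrite (_ : (fun w => _) = (fun w => (-1) *: X w)).
  by apply: entry_measurableZ => //; exact: measurable_cst.
by apply/funext => w; rewrite scaleN1r.
Qed.

Lemma entry_measurableM m n p (X : T -> 'M[R]_(m, n)) (Y : T -> 'M[R]_(n, p)) :
  entry_measurable X -> entry_measurable Y ->
  entry_measurable (fun w => X w *m Y w).
Proof.
move=> mX mY i j.
rewrite (_ : (fun w => _) = (fun w => \sum_k (X w i k * Y w k j))); last first.
  by apply/funext => w; rewrite mxE.
by apply: measurable_sum => k; exact: measurable_funM.
Qed.

Lemma entry_measurable_tr m n (X : T -> 'M[R]_(m, n)) :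
  entry_measurable X -> entry_measurable (fun w => (X w)^T).
Proof.
move=> mX i j; rewrite (_ : (fun w => _) = (fun w => X w j i)); first exact: mX.
by apply/funext => w; rewrite mxE.
Qed.

Lemma measurable_frob_inner m n (X Y : T -> 'M[R]_(m, n)) :
  entry_measurable X -> entry_measurable Y ->
  measurable_fun [set: T] (fun w => frob_inner (X w) (Y w)).
Proof.
move=> mX mY; rewrite /frob_inner /mxtrace; apply: measurable_sum => i.
by apply: entry_measurableM => //; exact: entry_measurable_tr.
Qed.

Lemma measurable_frob_norm m n (X : T -> 'M[R]_(m, n)) :
  entry_measurable X -> measurable_fun [set: T] (fun w => frob_norm (X w)).
Proof.
move=> mX; rewrite /frob_norm.
rewrite (_ : (fun w => _) = Num.sqrt \o (fun w => frob_inner (X w) (X w)))//.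
apply: measurableT_comp; first by apply: continuous_measurable_fun;
  exact: sqrt_continuous.
exact: measurable_frob_inner.
Qed.

End EntryMeasurable.

Lemma entry_measurable_comp d d' (T : measurableType d) (T' : measurableType d')
    (R : realType) m n (X : T' -> 'M[R]_(m, n)) (g : T -> T') :
  entry_measurable X -> measurable_fun [set: T] g ->
  entry_measurable (X \o g).
Proof.
move=> mX mg i j.
rewrite (_ : (fun w => _) = (fun w => X w i j) \o g)//.
by apply: measurableT_comp => //; exact: mX.
Qed.

Lemma entry_measurable_borel_cV (R : realType) n :
  entry_measurable (id : borel_cV R n -> 'cV[R]_n).
Proof.
move=> i j; apply: (measurability _ (RGenOpens.measurableE R)).
move=> _ [U [a [b UE]] <-]; rewrite setTI; apply: sub_sigma_algebra.
rewrite UE.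
apply: (open_comp (f := fun M : 'cV[R]_n => M i j)).
  by move=> M _; exact: coord_continuous.
exact: interval_open.
Qed.

Section CostMeasurable.
Context {R : realType} {n m : nat}.
Variables (A : 'M[R]_n) (B : 'M[R]_(n, m)) (Q : 'M[R]_n) (S : 'M[R]_m).
Hypotheses (Qpd : sym_posdef Q) (Spd : sym_posdef S).
Variable D : probability (borel_cV R n) R.

Lemma quad_form_ge0 k (Z : 'M[R]_k) (x : 'cV[R]_k) :
  sym_posdef Z -> 0 <= quad_form Z x.
Proof.
move=> [_ pd]; have [->|/pd/ltW//] := eqVneq x 0.
by rewrite /quad_form mulmx0 mxE.
Qed.

Lemma lqr_stage_cost_ge0 K x : 0 <= lqr_stage_cost Q S K x.
Proof. by rewrite addr_ge0// quad_form_ge0. Qed.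

(** Policy and initial state both vary, since the lemma is used twice: on a product space for
    Tonelli, and with a constant policy to bound the cost of a stable policy. *)
Lemma measurable_lqr_path_cost d (T : measurableType d)
    (K : T -> 'M[R]_(m, n)) (X0 : T -> 'cV[R]_n) :
  entry_measurable K -> entry_measurable X0 ->
  measurable_fun [set: T] (fun z => \sum_(0 <= i <oo)
    (lqr_stage_cost Q S (K z) (lqr_state A B (K z) (X0 z) i))%:E)%E.
Proof.
move=> mK mX0.
have mact (x : T -> 'cV[R]_n) : entry_measurable x ->
    entry_measurable (fun z => lqr_action (K z) (x z)).
  by move=> mx; apply: entry_measurableN; exact: entry_measurableM.
have mstate i : entry_measurable (fun z => lqr_state A B (K z) (X0 z) i).
  elim: i => [//|i IH] /=.
  have mc k (Z : 'M[R]_(n, k)) (x : T -> 'cV[R]_k) :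
      entry_measurable x -> entry_measurable (fun z => Z *m x z).
    by move=> mx; apply: entry_measurableM => //; exact: entry_measurable_cst.
  by apply: entry_measurableD; apply: mc => //; exact: mact.
have mquad k (Z : 'M[R]_k) (x : T -> 'cV[R]_k) :
    entry_measurable x -> measurable_fun setT (fun z => quad_form Z (x z)).
  move=> mx; rewrite /quad_form.
  apply: (entry_measurableM (X := fun z => (x z)^T *m Z)) => //.
  apply: entry_measurableM; last exact: entry_measurable_cst.
  exact: entry_measurable_tr.
apply: ge0_emeasurable_sum => [i z _ _|i _].
  by rewrite lee_fin lqr_stage_cost_ge0.
apply/measurable_EFinP; rewrite /lqr_stage_cost.
by apply: measurable_funD; apply: mquad => //; exact: mact.
Qed.

(* Tonelli: the cost is jointly measurable in the policy and the initial
   state. *)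
Lemma measurable_lqr_cost d (T : measurableType d) (K : T -> 'M[R]_(m, n)) :
  entry_measurable K ->
  measurable_fun [set: T] (fun w => lqr_cost A B Q S D (K w)).
Proof.
move=> mK.
pose c (z : T * borel_cV R n) : \bar R := (\sum_(0 <= i <oo)
  (lqr_stage_cost Q S (K z.1) (lqr_state A B (K z.1) z.2 i))%:E)%E.
have mc : measurable_fun [set: T * borel_cV R n] c.
  apply: measurable_lqr_path_cost.
    by apply: (entry_measurable_comp mK); exact: measurable_fst.
  apply: (entry_measurable_comp (@entry_measurable_borel_cV R n)).
  exact: measurable_snd.
apply: (measurable_fun_fubini_tonelli_F (m2 := D) c mc) => z.
by apply: nneseries_ge0 => i _ _; rewrite lee_fin lqr_stage_cost_ge0.
Qed.

End CostMeasurable.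

(** * Conditional expectations *)

Lemma measurable_set_bool d (T : measurableType d) (p : T -> bool) :
  measurable_fun [set: T] p -> measurable [set x | p x].
Proof.
move=> mp; rewrite (_ : [set x | p x] = setT `&` p @^-1` [set true]).
  exact: mp.
by rewrite setTI; apply/seteqP; split.
Qed.

(** Tonelli applied to [h w], written as the length of [[0, h w[]. It reduces integration against a
    weight to integration over events, the only integrals that [condexp_ge0] controls. *)
Lemma ge0_layer_cake d (W : measurableType d) (R : realType)
    (P : probability W R) (Z : W -> \bar R) (h : W -> R) :
  (forall w, 0 <= Z w)%E -> measurable_fun [set: W] Z ->
  (forall w, 0 <= h w) -> measurable_fun [set: W] h ->
  (\int[P]_w (Z w * (h w)%:E) =
   \int[lebesgue_measure]_s \int[P]_(w in [set w | 0 <= s < h w]%R) Z w)%E.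
Proof.
move=> Z0 mZ h0 mh.
pose U : set (W * R) := [set z | 0 <= z.2 < h z.1].
have mU : measurable U.
  apply: measurable_set_bool; apply: measurable_and.
    by apply: measurable_fun_ler => //; exact: measurable_snd.
  by apply: measurable_fun_ltr; [exact: measurable_snd|exact: measurableT_comp].
pose f (z : W * R) : \bar R := (Z z.1 * (\1_U z)%:E)%E.
have mf : measurable_fun [set: W * R] f.
  apply: emeasurable_funM; first exact: measurableT_comp.
  by apply/measurable_EFinP; exact: measurable_indic.
have f0 z : (0 <= f z)%E by rewrite mule_ge0// lee_fin.
have UE w s : \1_U (w, s) = \1_`[0, h w[%classic s :> R.
  by rewrite !indicE; congr (_%:R); congr nat_of_bool; apply/idP/idP;
    rewrite !inE /U/= in_itv.
transitivity (\int[P]_w \int[lebesgue_measure]_s f (w, s))%E; last first.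
  rewrite (fubini_tonelli (m1 := P) (m2 := @lebesgue_measure R) f mf f0).
  apply: eq_integral => s _; rewrite [RHS]integral_mkcond.
  apply: eq_integral => w _; rewrite /f /= /patch indicE.
  rewrite (_ : ((w, s) \in U) = (w \in [set w | 0 <= s < h w])); last first.
    by apply/idP/idP; rewrite !inE.
  by case: ifPn; rewrite ?mule1 ?mule0.
apply: eq_integral => w _; rewrite /f /=.
under eq_integral do rewrite UE.
rewrite ge0_integralZl//; last by apply/measurable_EFinP;
  exact: measurable_indic.
rewrite integral_indic// setIT; congr (_ * _)%E; apply: esym.
rewrite [LHS](lebesgue_measure_itv `[0, h w[) /= lte_fin sube0.
by case: ltP => // h1; congr (_%:E); apply/eqP; rewrite eq_le h0 h1.
Qed.

Section ConditionalExpectation.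
Context {d} {W : measurableType d} {R : realType} (P : probability W R).
Variable H : set (set W).
Hypotheses (sH : sigma_algebra [set: W] H) (HW : H `<=` @measurable d W).

Lemma measurable_wrtE (E : set W) :
  @measurable _ (g_sigma_algebraType H) E -> H E.
Proof. by apply; split. Qed.

Lemma measurable_wrtW d' (V : measurableType d') (X : W -> V) :
  measurable_wrt H X -> measurable_fun [set: W] X.
Proof.
by move=> mX _ Y mY; apply: HW; apply: measurable_wrtE; exact: mX.
Qed.

(** The events [0 <= s < h] lie in [H], so after the layer cake the identity defining [Y] applies
    slice by slice. Both sides may be [+oo]. *)
Lemma condexp_ge0_mulr (X Y : W -> \bar R) (h : W -> R) :
  (forall w, 0 <= X w)%E -> measurable_fun [set: W] X ->
  condexp_ge0 P H X Y ->
  (forall w, 0 <= h w) -> measurable_wrt H h ->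
  (\int[P]_w (Y w * (h w)%:E) = \int[P]_w (X w * (h w)%:E))%E.
Proof.
move=> X0 mX [mY Y0 YX] h0 mh.
rewrite !ge0_layer_cake//; [|exact: measurable_wrtW..].
apply: eq_integral => s _; apply: YX; apply: measurable_wrtE.
apply: (@measurable_set_bool _ (g_sigma_algebraType H)).
apply: (@measurable_and _ (g_sigma_algebraType H)).
  exact: measurable_cst.
by apply: (@measurable_fun_ltr _ (g_sigma_algebraType H)).
Qed.

End ConditionalExpectation.

(** * Azuma's inequality *)

(** The linear term disappears under a non-positive mean, leaving a Gaussian bound. For [x >= 1/2],
    [x <= 2 x^2]; below, [exp x <= 1/(1 - x) <= 1 + x + 2 x^2], because [(1 + x + 2 x^2)(1 - x) = 1
    + x^2 (1 - 2 x)]. *)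
Lemma expR_le_add_expR_sqr (R : realType) (x : R) :
  expR x <= x + expR (2 * x ^+ 2).
Proof.
have e2 := expR_ge1Dx (2 * x ^+ 2).
have [x1|x1] := leP (2^-1) x.
  apply: le_trans (_ : expR (2 * x ^+ 2) <= _); last first.
    by rewrite lerDr (le_trans _ x1)// invr_ge0.
  by rewrite ler_expR; nra.
apply: le_trans (_ : 1 + x + 2 * x ^+ 2 <= _); last by lra.
have xN : 0 < 1 - x by lra.
have -> : expR x = (expR (- x))^-1 by rewrite expRN invrK.
rewrite -[leRHS]invrK lef_pV2 ?posrE ?expR_gt0 ?invr_gt0//; last by nra.
apply: le_trans (expR_ge1Dx (- x)).
rewrite -[leRHS]invrK lef_pV2 ?posrE ?invr_gt0//; [|by nra..].
rewrite -[leLHS]mul1r ler_pdivrMr//; nra.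
Qed.

Lemma bounded_integrable d (W : measurableType d) (R : realType)
    (P : probability W R) (f : W -> R) (B : R) :
  measurable_fun [set: W] f -> (forall w, `|f w| <= B) ->
  P.-integrable [set: W] (EFin \o f).
Proof.
move=> mf fB; apply: (@le_integrable _ _ _ _ _ _ _ (cst B%:E)) => //.
- exact/measurable_EFinP.
- by move=> w _; rewrite lee_fin (le_trans (fB w))// ler_norm.
- exact: finite_measure_integrable_cst.
Qed.

Section Azuma.
Context {d} {W : measurableType d} {R : realType} (P : probability W R).
Variables (F : nat -> set (set W)) (X : nat -> W -> R) (c : nat -> R).
Hypothesis Ffilt : filtration F.
Hypothesis mX : forall t, measurable_wrt (F t.+1) (X t).
Hypothesis Xc : forall t w, `|X t w| <= c t.
(** The supermartingale property, stated by bounded non-negative tests instead of a conditional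
    expectation; being one-sided, it yields the upper tail only. *)
Hypothesis drift : forall t (h : W -> R) (B : R),
  measurable_wrt (F t) h -> (forall w, 0 <= h w <= B) ->
  (\int[P]_w (h w * X t w)%:E <= 0)%E.

Let S t w := \sum_(s < t) X s w.

Lemma measurable_wrt_le s t d' (V : measurableType d') (Y : W -> V) :
  (s <= t)%N -> measurable_wrt (F s) Y -> measurable_wrt (F t) Y.
Proof.
move=> st mY _ U mU; have [sF FW FS] := Ffilt.
apply: sub_sigma_algebra.
suff h : F s `<=` F t by apply: h; apply: measurable_wrtE => //; exact: mY.
elim: t st => [|t IH]; first by rewrite leqn0 => /eqP ->.
rewrite leq_eqVlt => /orP[/eqP -> //|/IH].
by move=> h E /h; exact: FS.
Qed.

Lemma measurable_wrt_psum t : measurable_wrt (F t) (S t).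
Proof.
apply: (@measurable_sum _ (g_sigma_algebraType (F t))) => s.
exact (@measurable_wrt_le s.+1 t _ _ (X s) (ltn_ord s) (@mX s)).
Qed.

Lemma psum_le t w : `|S t w| <= \sum_(s < t) c s.
Proof.
by apply: le_trans (ler_norm_sum _ _ _) _; apply: ler_sum => s _; exact: Xc.
Qed.

(** The weight [h = exp (l S_t)] is bounded and [F t]-measurable, hence an admissible test in
    [drift]; this removes the linear term of [expR_le_add_expR_sqr] at [l X_t], and each step costs
    a factor [exp (2 l^2 c_t^2)]. *)
Lemma azuma_mgf (l : R) t : 0 <= l ->
  (\int[P]_w (expR (l * S t w))%:E
    <= (expR (2 * l ^+ 2 * \sum_(s < t) c s ^+ 2))%:E)%E.
Proof.
move=> l0; elim: t => [|t IH].
  rewrite big_ord0 mulr0 expR0.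
  under eq_integral do rewrite /S big_ord0 mulr0 expR0.
  by rewrite integral_cst//= probability_setT mule1.
have [sF FW FS] := Ffilt.
pose h w := expR (l * S t w).
have mh : measurable_wrt (F t) h.
  apply: (@measurableT_comp _ _ _ (g_sigma_algebraType (F t))).
    exact: measurable_expR.
  apply: (@measurable_funM _ (g_sigma_algebraType (F t))).
    exact: measurable_cst.
  exact: measurable_wrt_psum.
pose B := expR (l * \sum_(s < t) c s).
have hB w : 0 <= h w <= B.
  rewrite expR_ge0 ler_expR ler_wpM2l//.
  exact: le_trans (ler_norm _) (psum_le _ _).
have mhW : measurable_fun setT h by exact: (measurable_wrtW (sF t) (FW t) mh).
have mXW s : measurable_fun setT (X s) by exact: (measurable_wrtW (sF s.+1) (FW
  s.+1) (@mX s)).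
pose g := expR (2 * l ^+ 2 * c t ^+ 2).
have ih : P.-integrable setT (EFin \o h).
  apply: (@bounded_integrable _ _ _ P _ B) => // w.
  by have /andP[h0 ?] := hB w; rewrite ger0_norm.
have ihX : P.-integrable setT (EFin \o (fun w => h w * X t w)).
  apply: (@bounded_integrable _ _ _ P _ (B * c t)).
    exact: measurable_funM.
  move=> w; have /andP[h0 ?] := hB w.
  by rewrite normrM ler_pM// ger0_norm.
have le1 w : expR (l * S t.+1 w) <= l * (h w * X t w) + g * h w.
  rewrite /S big_ord_recr/= -/(S t w) mulrDr expRD -/(h w).
  have := expR_le_add_expR_sqr (l * X t w).
  have : expR (2 * (l * X t w) ^+ 2) <= g.
    rewrite /g ler_expR exprMn mulrA ler_wpM2l//.
      by rewrite mulr_ge0// sqr_ge0.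
    by rewrite -[leLHS]real_normK ?num_real// lerXn2r ?nnegrE// (le_trans _ (Xc
      t w)).
  move=> a b; have /andP[h0 _] := hB w.
  have -> : l * (h w * X t w) + g * h w = h w * (l * X t w + g) by ring.
  by rewrite ler_wpM2l//; lra.
apply: (@le_trans _ _ (\int[P]_w (l * (h w * X t w) + g * h w)%:E)%E).
  apply: ge0_le_integral => //.
  - apply/measurable_EFinP; apply: measurableT_comp => //.
    apply: measurable_funM => //.
    by apply: measurable_sum => s; exact: mXW.
  - apply/measurable_EFinP; apply: measurable_funD; apply: measurable_funM =>
    //.
    exact: measurable_funM.
  - by move=> w _; rewrite lee_fin.
under eq_integral do rewrite EFinD.
rewrite integralD//=; last 2 first.
- under eq_fun do rewrite EFinM; exact: integrableZl.
- under eq_fun do rewrite EFinM; exact: integrableZl.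
under eq_integral do rewrite EFinM.
rewrite integralZl//.
under [X in (_ + X <= _)%E]eq_integral do rewrite EFinM.
rewrite integralZl//= big_ord_recr/= mulrDr expRD EFinM muleC.
rewrite -[leRHS]add0e; apply: leeD.
  by rewrite mule_le0_ge0 ?(drift mh hB)// lee_fin.
by rewrite -/g muleC lee_wpmul2r// lee_fin expR_ge0.
Qed.

Lemma azuma_tail t (a : R) : 0 < a -> 0 < \sum_(s < t) c s ^+ 2 ->
  (P [set w | (a <= \sum_(s < t) X s w)%R] <=
   (expR (- (a ^+ 2 / (8 * \sum_(s < t) c s ^+ 2))))%:E)%E.
Proof.
move=> a0; set v := \sum_(s < t) _ => v0.
have [sF FW FS] := Ffilt.
(* The minimizer of the Chernoff exponent [- l a + 2 l^2 v], whose minimum is [- a^2 / (8 v)]. *)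
pose l := a / (4 * v).
have l0 : 0 < l by rewrite divr_gt0// mulr_gt0.
have mS : measurable_fun setT (S t).
  have h := @measurable_wrt_psum t.
  exact: (measurable_wrtW (sF t) (FW t) h).
have mE : measurable [set w | a <= S t w].
  by apply: measurable_set_bool; apply: measurable_fun_ler.
rewrite -[X in P X]setIT -integral_indic//.
apply: (@le_trans _ _ (\int[P]_w ((expR (- (l * a)))%:E * (expR (l * S t
  w))%:E))%E).
  apply: ge0_le_integral => //.
  - by apply/measurable_EFinP; exact: measurable_indic.
  - apply: emeasurable_funM => //; apply/measurable_EFinP.
    by apply: measurableT_comp => //; exact: measurable_funM.
  - move=> w _; rewrite -EFinM lee_fin -expRD indicE.
    case: (boolP (w \in _)) => [|_]; last exact: expR_ge0.
    rewrite inE /= => aS; rewrite -expR0 ler_expR addrC subr_ge0.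
    by rewrite ler_wpM2l// ltW.
rewrite ge0_integralZl//; last first.
  apply/measurable_EFinP.
  by apply: measurableT_comp => //; exact: measurable_funM.
apply: le_trans.
  by apply: lee_wpmul2l (azuma_mgf t (ltW l0)); rewrite lee_fin expR_ge0.
rewrite -EFinM lee_fin -expRD ler_expR -/v.
rewrite le_eqVlt; apply/orP; left; apply/eqP; rewrite /l.
by field; rewrite gt_eqF.
Qed.

End Azuma.

(** * Measurability of the gradient *)

Section Gradient.
Context {R : realType} {m n : nat}.
Implicit Types (f : 'M[R]_(m, n) -> \bar R) (K v g : 'M[R]_(m, n)).

(** A limsup over the countable family of steps [1/(k+1)]: it always exists and is measurable in
    [K], unlike a derivative. *)
Definition upper_slope f K v : \bar R :=
  limn_esup (fun k => (k.+1%:R *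
    (fine (f (K + k.+1%:R^-1 *: v)) - fine (f K)))%:E).

Definition has_upper_model f K g (c r : R) : Prop :=
  forall K', frob_norm (K' - K) <= r ->
    (f K' <= f K + (frob_inner g (K' - K) + c * frob_norm (K - K') ^+ 2)%:E)%E.

(** Dividing the upper model by the step [1/(k+1)] leaves the remainder [c |v|^2 / (k+1)]. The model
    and [lb] together make [f] finite near [K], so [fine] is faithful there. *)
Lemma upper_slope_le f K g c r v (lb : R) :
  0 <= c -> 0 < r -> f K \is a fin_num -> (forall K', (lb%:E <= f K')%E) ->
  has_upper_model f K g c r -> (upper_slope f K v <= (frob_inner g v)%:E)%E.
Proof.
move=> c0 r0 fK flb fup; apply/lee_addgt0Pr => e e0.
rewrite /upper_slope limn_esup_lim; apply: lime_le; first exact: is_cvg_esups.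
have nv := frob_norm_ge0 v.
(* Steps below the first bound stay in the ball of radius [r], steps below the second have remainder
   at most [e]; the [+ 1] guards against [v = 0] and [c = 0]. *)
have e1 : 0 < r / (frob_norm v + 1) by rewrite divr_gt0 ?ltr_wpDl.
have e2 : 0 < e / (c * frob_norm v ^+ 2 + 1).
  by rewrite divr_gt0// ltr_wpDl// mulr_ge0// sqr_ge0.
near=> N; apply: ge_ereal_sup => _ [k /= Nk <-].
have k0 : 0 < k.+1%:R :> R by rewrite ltr0n.
have kN : k.+1%:R^-1 <= N.+1%:R^-1 :> R by rewrite lef_pV2 ?posrE// ler_nat.
have N1 : N.+1%:R^-1 < r / (frob_norm v + 1) by near: N;
  exact: near_infty_natSinv_lt (PosNum e1).
have N2 : N.+1%:R^-1 < e / (c * frob_norm v ^+ 2 + 1) by near: N;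
  exact: near_infty_natSinv_lt (PosNum e2).
have ki : 0 < k.+1%:R^-1 :> R by rewrite invr_gt0.
have vN : frob_norm (K + k.+1%:R^-1 *: v - K) = k.+1%:R^-1 * frob_norm v.
  by rewrite addrAC subrr add0r frob_normZ gtr0_norm.
have := fup (K + k.+1%:R^-1 *: v).
rewrite vN (frob_normB K) vN.
have le1 : k.+1%:R^-1 * frob_norm v <= r.
  have : k.+1%:R^-1 <= r / (frob_norm v + 1) by rewrite ltW// (le_lt_trans kN).
  rewrite ler_pdivlMr ?ltr_wpDl// => /(le_trans _); apply.
  by apply: ler_wpM2l; [exact: ltW|rewrite lerDl].
move=> /(_ le1); have := flb (K + k.+1%:R^-1 *: v).
rewrite addrAC subrr add0r frob_innerZr.
case: (f (K + _)) => [z| |]//; rewrite -(fineK fK) -EFinD ?lee_fin// => _ /= h.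
have h2 : k.+1%:R^-1 * (c * frob_norm v ^+ 2) <= e.
  have : k.+1%:R^-1 <= e / (c * frob_norm v ^+ 2 + 1) by rewrite ltW//
    (le_lt_trans kN).
  rewrite ler_pdivlMr ?ltr_wpDl ?mulr_ge0 ?sqr_ge0// => /(le_trans _); apply.
  by apply: ler_wpM2l; [exact: ltW|rewrite lerDl].
rewrite -ler_pdivlMl// lerBlDl (le_trans h)// lerD2l mulrDr lerD2l exprMn.
rewrite [leLHS](_ : _ = k.+1%:R^-1 * (k.+1%:R^-1 * (c * frob_norm v ^+ 2))).
  by apply: ler_wpM2l => //; exact: ltW.
by rewrite !expr2; ring.
Unshelve. all: by end_near. Qed.

(** Used with [s = 1] and [s = -1]: differentiability forces the two slopes to be opposite, which is
    the test in [grad_entryE]. The sequence [s/(k+1)] tends to [0] and avoids it, as the punctured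
    limit requires. *)
Lemma upper_slope_derivable f K i j (s : R) : s != 0 ->
  derivable (fun X => fine (f X)) K (delta_mx i j) ->
  upper_slope f K (s *: delta_mx i j) = (s * grad f K i j)%:E.
Proof.
move=> s0 df; rewrite /upper_slope.
have -> : grad f K i j = 'D_(delta_mx i j) (fun X => fine (f X)) K by rewrite
  mxE.
have := df; rewrite /derivable -/('D_(delta_mx i j) (fun X => fine (f X)) K).
move/cvgr_dnbhsP => /(_ (fun k => k.+1%:R^-1 * s)) h.
have {}h := h _.
have sE k : s * ((k.+1%:R^-1 * s)^-1 *: (((fun X => fine (f X)) \o shift K)
  ((k.+1%:R^-1 * s) *: delta_mx i j) - fine (f K))) = k.+1%:R *
    (fine (f (K + k.+1%:R^-1 *: (s *: delta_mx i j))) - fine (f K)).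
  rewrite /= scalerA addrC /GRing.scale/= invfM invrK.
  rewrite [_ *: _ + _]addrC.
  by field.
set u := (X in limn_esup X).
suff : u @ \oo --> (s * 'D_(delta_mx i j) (fun X => fine (f X)) K)%:E.
  by move/cvg_limn_einf_sup => [_].
apply/fine_cvgP; split; first exact: nearW.
rewrite (_ : fine \o u = (fun k => s * ((k.+1%:R^-1 * s)^-1 *: (((fun X => fine
  (f X)) \o shift K)
  ((k.+1%:R^-1 * s) *: delta_mx i j) - fine (f K))))); last first.
  by apply/funext => k; rewrite sE.
apply: cvgMr; apply: h; split=> [k|].
  by rewrite mulf_neq0// invr_eq0 pnatr_eq0.
rewrite -[X in _ --> X](mul0r s); apply: cvgMl; exact: cvg_harmonic.
Qed.

(* The upper model puts the partial derivative between the two one-sided slopes;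
   if these differ, [f] is not differentiable and the partial derivative is the
   junk value [point = 0]. *)
Lemma grad_entryE f K c r (lb : R) i j :
  0 <= c -> 0 < r -> f K \is a fin_num -> (forall K', (lb%:E <= f K')%E) ->
  has_upper_model f K (grad f K) c r ->
  (grad f K i j)%:E =
    if upper_slope f K (delta_mx i j) == (- upper_slope f K (- delta_mx i j))%E
    then upper_slope f K (delta_mx i j) else 0%E.
Proof.
move=> c0 r0 fK flb fup.
have := upper_slope_le (delta_mx i j) c0 r0 fK flb fup.
have := upper_slope_le (- delta_mx i j) c0 r0 fK flb fup.
rewrite frob_inner_deltar -scaleN1r frob_innerZr frob_inner_deltar mulN1r.
case: eqP => [->|ne] h1 h2.
  by apply/eqP; rewrite eq_le h2 andbT leeNr.
have nd : ~ derivable (fun X => fine (f X)) K (delta_mx i j).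
  move=> df; apply: ne; rewrite upper_slope_derivable ?oppr_eq0 ?oner_eq0//.
  by rewrite -[X in upper_slope f K X]scale1r upper_slope_derivable ?oner_eq0//
    mulN1r mul1r EFinN oppeK.
by rewrite mxE /derive dvgP.
Qed.

Lemma measurable_upper_slope d (T : measurableType d) f (K : T -> 'M[R]_(m, n))
  v :
  (forall X : T -> 'M[R]_(m, n), entry_measurable X ->
     measurable_fun [set: T] (f \o X)) ->
  entry_measurable K ->
  measurable_fun [set: T] (fun w => upper_slope f (K w) v).
Proof.
move=> mf mK; rewrite /upper_slope.
apply: (measurable_fun_limn_esup
  (f := fun k w => (k.+1%:R *
    (fine (f (K w + k.+1%:R^-1 *: v)) - fine (f (K w))))%:E)) => k.
apply/measurable_EFinP; apply: measurable_funM => //.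
apply: measurable_funB.
  apply: (measurableT_comp (f := fine)); first exact: fine_measurable.
  apply: (mf (fun w => K w + k.+1%:R^-1 *: v)).
  by apply: entry_measurableD => //; exact: entry_measurable_cst.
apply: (measurableT_comp (f := fine)); first exact: fine_measurable.
exact: mf.
Qed.

(* [grad f] need not be measurable everywhere, only where [f] has an upper
   model. *)
Lemma entry_measurable_grad d (T : measurableType d) f (K : T -> 'M[R]_(m, n))
    (c r lb : R) (E : set T) :
  (forall X : T -> 'M[R]_(m, n), entry_measurable X ->
     measurable_fun [set: T] (f \o X)) ->
  entry_measurable K -> measurable E ->
  0 <= c -> 0 < r -> (forall K', (lb%:E <= f K')%E) ->
  (forall w, E w -> f (K w) \is a fin_num /\
                    has_upper_model f (K w) (grad f (K w)) c r) ->
  entry_measurable (fun w => \1_E w *: grad f (K w)).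
Proof.
move=> mf mK mE c0 r0 flb fE i j; apply/measurable_EFinP.
pose a s w := upper_slope f (K w) (s *: delta_mx i j).
have ma s : measurable_fun setT (a s) by exact: measurable_upper_slope.
pose g w := if a 1 w == (- a (- 1)%R w)%E then a 1 w else 0%E.
rewrite (_ : _ \o _ = fun w => ((\1_E w)%:E * g w)%E); last first.
  apply/funext => w /=; rewrite mxE EFinM indicE.
  case: (boolP (w \in E)) => [|_]; last by rewrite !mul0e.
  rewrite inE => /fE[fin up]; rewrite !mul1e /g /a scale1r scaleN1r.
  exact: grad_entryE c0 r0 fin flb up.
apply: emeasurable_funM; first by apply/measurable_EFinP;
  exact: measurable_indic.
apply: measurable_fun_if => //.
- apply: measurable_fun_eqe => //; exact: measurableT_comp.
- exact: measurable_funS (ma 1).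
Qed.

End Gradient.

(** * Means and conditional means *)

Section Mean.
Context {d} {W : measurableType d} {R : realType} (P : probability W R).
Implicit Types (f g : W -> R) (a b : R).

(** Integrability and the real value travel together, so that means can be combined in [R] without
    infinite values. *)
Definition has_mean f a : Prop :=
  P.-integrable [set: W] (EFin \o f) /\ (\int[P]_w (f w)%:E = a%:E)%E.

Lemma has_mean_measurable f a : has_mean f a -> measurable_fun [set: W] f.
Proof. by move=> [/measurable_int/measurable_EFinP]. Qed.

Lemma integrable_has_mean f :
  P.-integrable [set: W] (EFin \o f) -> exists a, has_mean f a.
Proof.
move=> fi; exists (fine (\int[P]_w (f w)%:E)%E); split => //.
by rewrite fineK// (integrable_fin_num _ fi).
Qed.

Lemma bounded_has_mean f (B : R) : measurable_fun [set: W] f ->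
  (forall w, `|f w| <= B) -> exists a, has_mean f a.
Proof.
move=> mf fB; apply: integrable_has_mean; exact: bounded_integrable mf fB.
Qed.

Lemma has_mean_eq f g a : has_mean f a -> f =1 g -> has_mean g a.
Proof. by move=> h /funext <-. Qed.

Lemma has_meanD f g a b : has_mean f a -> has_mean g b ->
  has_mean (fun w => f w + g w) (a + b).
Proof.
move=> [fi fa] [gi gb]; split.
  rewrite (_ : _ \o _ = (EFin \o f) \+ (EFin \o g))%E//.
  exact: integrableD.
by under eq_integral do rewrite EFinD; rewrite integralD// fa gb.
Qed.

Lemma has_meanZ f a (k : R) : has_mean f a -> has_mean (fun w => k * f w) (k *
  a).
Proof.
move=> [fi fa]; split.
  rewrite (_ : _ \o _ = fun w => k%:E * (EFin \o f) w)%E//.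
  exact: integrableZl.
by under eq_integral do rewrite EFinM; rewrite integralZl// fa.
Qed.

Lemma has_meanB f g a b : has_mean f a -> has_mean g b ->
  has_mean (fun w => f w - g w) (a - b).
Proof.
move=> fa /(has_meanZ (-1)) gb; rewrite -mulN1r.
by apply: has_mean_eq (has_meanD fa gb) _ => w; rewrite mulN1r.
Qed.

Lemma has_mean_sum n (f : 'I_n -> W -> R) (a : 'I_n -> R) :
  (forall i, has_mean (f i) (a i)) ->
  has_mean (fun w => \sum_i f i w) (\sum_i a i).
Proof.
elim: n f a => [|n IH] f a fa.
  rewrite big_ord0; split.
    rewrite (_ : _ \o _ = cst 0%:E); last first.
      by apply/funext => w /=; rewrite big_ord0.
    exact: finite_measure_integrable_cst.
  by apply: integral0_eq => w _; rewrite big_ord0.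
rewrite big_ord_recl; apply: has_mean_eq (has_meanD (fa ord0) (IH _ _ _)) _.
  by move=> i; exact: fa.
by move=> w; rewrite [RHS]big_ord_recl.
Qed.

Lemma has_mean_ae f g a : measurable_fun [set: W] g -> has_mean f a ->
  {ae P, forall w, f w = g w} -> has_mean g a.
Proof.
move=> mg fa fg; have mf := has_mean_measurable fa; case: fa => fi fa.
have mgE : measurable_fun setT (EFin \o g) by exact/measurable_EFinP.
split; last first.
  rewrite -fa; apply: ae_eq_integral => //; first exact/measurable_EFinP.
  by apply: filterS fg => w /= ->.
move/integrableP : fi => [_ fi]; apply/integrableP; split => //.
rewrite (ae_eq_integral (fun w => `|(EFin \o f) w|)%E)//.
- exact: measurableT_comp.
- by apply: measurableT_comp => //; exact/measurable_EFinP.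
- by apply: filterS fg => w /= ->.
Qed.

Lemma has_mean_ge0 f a : has_mean f a -> {ae P, forall w, 0 <= f w} -> 0 <= a.
Proof.
move=> fa f0.
have [_ h] : has_mean (fun w => `|f w|) a.
  apply: (has_mean_ae _ fa).
    by apply: measurableT_comp => //; exact: has_mean_measurable fa.
  by apply: filterS f0 => w /ger0_norm.
by rewrite -lee_fin -h; apply: integral_ge0 => w _; rewrite lee_fin.
Qed.

Lemma has_mean_le f g a b : has_mean f a -> has_mean g b ->
  {ae P, forall w, f w <= g w} -> a <= b.
Proof.
move=> fa gb fg; rewrite -subr_ge0; apply: has_mean_ge0 (has_meanB gb fa) _.
by apply: filterS fg => w; rewrite subr_ge0.
Qed.

Lemma ge0_has_mean f (v : R) : (forall w, 0 <= f w) ->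
  measurable_fun [set: W] f -> (\int[P]_w (f w)%:E <= v%:E)%E ->
  exists2 a, has_mean f a & a <= v.
Proof.
move=> f0 mf fv.
have fi : P.-integrable setT (EFin \o f).
  apply/integrableP; split; first exact/measurable_EFinP.
  under eq_integral do rewrite /= ger0_norm//.
  by rewrite (le_lt_trans fv)// ltry.
have [a fa] := integrable_has_mean fi.
by exists a => //; rewrite -lee_fin -fa.2.
Qed.

End Mean.

Section ConditionalMean.
Context {d} {W : measurableType d} {R : realType} (P : probability W R).
Variable H : set (set W).
Hypotheses (sH : sigma_algebra [set: W] H) (HW : H `<=` @measurable d W).

(** Only [X * k] is integrable, not [X]. Hence [X^+ * k] and [X^- * k] have finite integrals, which
    makes [Yp] and [Yn] finite almost surely where [k > 0]; there [fine] commutes with the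
    difference, and elsewhere [k] kills both sides. *)
Lemma condexp_mulr (X : W -> R) (Y : W -> \bar R) (k : W -> R) (a : R) :
  condexp P H X Y -> measurable_fun [set: W] X ->
  (forall w, 0 <= k w) -> measurable_wrt H k ->
  has_mean P (fun w => X w * k w) a ->
  has_mean P (fun w => fine (Y w) * k w) a.
Proof.
move=> [Yp [Yn [Hp Hn YE]]] mX k0 mk Xk.
have mkW := measurable_wrtW sH HW mk.
have part (Z : W -> \bar R) (X' : W -> R) : (forall w, 0 <= X' w <= `|X w|) ->
    measurable_fun setT X' -> condexp_ge0 P H (EFin \o X') Z ->
    exists b, [/\ has_mean P (fun w => X' w * k w) b,
      has_mean P (fun w => fine (Z w) * k w) b &
      {ae P, forall w, 0 < k w -> Z w \is a fin_num}].
  move=> X'X mX' HZ.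
  have X'0 w : 0 <= X' w by case/andP: (X'X w).
  have [b Xb] : exists b, has_mean P (fun w => X' w * k w) b.
    apply: integrable_has_mean; case: Xk => Xi _.
    apply: le_integrable Xi => //.
      by apply/measurable_EFinP; exact: measurable_funM.
    move=> w _ /=; rewrite lee_fin !normrM ler_wpM2r// ger0_norm//.
    by case/andP: (X'X w).
  have [mZ Z0 _] := HZ.
  have mZW := measurable_wrtW sH HW mZ.
  have mXE : measurable_fun setT (EFin \o X') by exact/measurable_EFinP.
  have XE0 w : (0 <= (EFin \o X') w)%E by rewrite lee_fin.
  have := condexp_ge0_mulr sH HW XE0 mXE HZ k0 mk.
  have -> : (\int[P]_w ((EFin \o X') w * (k w)%:E) = b%:E)%E by case: Xb.
  move=> Zb; have mZk : measurable_fun setT (fun w => (Z w * (k w)%:E))%E.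
    by apply: emeasurable_funM => //; exact/measurable_EFinP.
  have Zk0 w : (0 <= Z w * (k w)%:E)%E by rewrite mule_ge0// lee_fin.
  have Zki : P.-integrable setT (fun w => (Z w * (k w)%:E))%E.
    apply/integrableP; split => //.
    by under eq_integral do rewrite gee0_abs//; rewrite Zb ltry.
  (* Where [k = 0] both sides are [0], even if [Z] is infinite; where [k > 0] a finite product
     forces a finite [Z]. *)
  have ZkE w : (Z w * (k w)%:E)%E \is a fin_num ->
      (fine (Z w) * k w)%:E = (Z w * (k w)%:E)%E.
    have := k0 w; rewrite le_eqVlt => /orP[/eqP <-|kp].
      by rewrite mulr0 mule0.
    by have := Z0 w; case: (Z w) => // _; rewrite gt0_mulye// lte_fin.
  have fin_ae := integrable_ae measurableT Zki.
  have mfk : measurable_fun setT (fun w => fine (Z w) * k w).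
    by apply: measurable_funM => //; apply: measurableT_comp => //;
      exact: fine_measurable.
  have ae_fk : ae_eq P setT (EFin \o (fun w => fine (Z w) * k w)) (fun w => (Z
    w * (k w)%:E))%E.
    by apply: filterS fin_ae => w /= h _; apply: ZkE; exact: h.
  exists b; split => //; last first.
    apply: filterS fin_ae => w h kp; have := h I; have := Z0 w.
    by case: (Z w) => //; rewrite gt0_mulye// lte_fin.
  split; last by rewrite -Zb; apply: ae_eq_integral => //;
    exact/measurable_EFinP.
  apply/integrableP; split; first exact/measurable_EFinP.
  rewrite (ae_eq_integral (fun w => Z w * (k w)%:E)%E)//.
  - by rewrite Zb ltry.
  - by apply: measurableT_comp => //; exact/measurable_EFinP.
  - apply: filterS ae_fk => w /= h _; rewrite -h//.
    by rewrite ger0_norm// mulr_ge0// fine_ge0.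
have [bp [Xbp Zbp fp]] : exists b, [/\ has_mean P (fun w => Num.max (X w) 0 * k
  w) b,
      has_mean P (fun w => fine (Yp w) * k w) b &
      {ae P, forall w, 0 < k w -> Yp w \is a fin_num}].
  apply: part.
  - move=> w; rewrite le_max lexx orbT /= ge_max ler_norm normr_ge0//.
  - exact: measurable_maxr.
  - rewrite (_ : _ \o _ = ((EFin \o X)^\+)%E)//.
    by apply/funext => w; rewrite /= funeposE /= -EFin_max.
have [bn [Xbn Zbn fn]] : exists b, [/\ has_mean P (fun w => Num.max (- X w) 0 *
  k w) b,
      has_mean P (fun w => fine (Yn w) * k w) b &
      {ae P, forall w, 0 < k w -> Yn w \is a fin_num}].
  apply: part.
  - by move=> w; rewrite le_max lexx orbT /= ge_max -normrN ler_norm normr_ge0.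
  - by apply: measurable_maxr => //; exact: measurable_funN.
  - rewrite (_ : _ \o _ = ((EFin \o X)^\-)%E)//.
    by apply/funext => w; rewrite funenegE /= EFin_max.
have abE : a = bp - bn.
  have := has_meanB Xbp Xbn; move=> h.
  have {}h := has_mean_eq h (g := fun w => X w * k w) _.
  have {h} : has_mean P (fun w => X w * k w) (bp - bn).
    apply: h => w; rewrite -mulrBl; congr (_ * _).
    have /orP[x0|x0] := le_total 0 (X w).
      by rewrite max_l// max_r ?oppr_le0// subr0.
    by rewrite max_r// max_l ?oppr_ge0// sub0r opprK.
  by move=> [_ h]; case: Xk => _; rewrite h => -[].
rewrite abE; apply: has_mean_ae (has_meanB Zbp Zbn) _.
  apply: measurable_funM => //; apply: measurableT_comp;
    first exact: fine_measurable.
  rewrite (_ : Y = (fun w => Yp w - Yn w)%E); last exact/funext.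
  by apply: emeasurable_funB; [case: Hp|case: Hn] => /(measurable_wrtW sH HW).
apply: filterS2 fp fn => w fp fn; rewrite YE.
have := k0 w; rewrite le_eqVlt => /orP[/eqP <-|kp]; first by rewrite !mulr0
  subr0.
by rewrite fineB ?fp ?fn// mulrBl.
Qed.

(** The bound on [Y] is asked only where [k > 0]: noise bounds valid on an event become usable by
    weights supported on it. *)
Lemma condexp_ge0_mean_le (X : W -> R) (Y : W -> \bar R) (k : W -> R) (v a : R)
  :
  (forall w, 0 <= X w) -> measurable_fun [set: W] X ->
  condexp_ge0 P H (EFin \o X) Y -> 0 <= v ->
  (forall w, 0 <= k w) -> measurable_wrt H k -> has_mean P k a ->
  {ae P, forall w, 0 < k w -> (Y w <= v%:E)%E} ->
  exists2 b, has_mean P (fun w => X w * k w) b & b <= v * a.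
Proof.
move=> X0 mX HY v0 k0 mk ka Yv.
have mkW := measurable_wrtW sH HW mk.
have [mY Y0 _] := HY; have mYW := measurable_wrtW sH HW mY.
have XE0 w : (0 <= (EFin \o X) w)%E by rewrite lee_fin.
have mXE : measurable_fun setT (EFin \o X) by exact/measurable_EFinP.
apply: ge0_has_mean.
- by move=> w; rewrite mulr_ge0.
- exact: measurable_funM.
rewrite (_ : (\int[P]_w _ = \int[P]_w ((EFin \o X) w * (k w)%:E))%E)//.
rewrite -(condexp_ge0_mulr sH HW XE0 mXE HY k0 mk).
have [_ <-] := has_meanZ v ka.
apply: ae_ge0_le_integral => //.
- by move=> w _; rewrite mule_ge0// lee_fin.
- by apply: emeasurable_funM => //; exact/measurable_EFinP.
- by move=> w _; rewrite lee_fin mulr_ge0.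
- by apply/measurable_EFinP; exact: measurable_funM.
apply: filterS Yv => w h _; have := k0 w; rewrite le_eqVlt => /orP[/eqP <-|kp].
  by rewrite mulr0 mule0.
by rewrite EFinM lee_wpmul2r ?lee_fin// h.
Qed.

Lemma condexp_ge0_mean_ge (X : W -> R) (Y : W -> \bar R) (k : W -> R) (v a b :
  R) :
  (forall w, 0 <= X w) -> measurable_fun [set: W] X ->
  condexp_ge0 P H (EFin \o X) Y -> 0 <= v ->
  (forall w, 0 <= k w) -> measurable_wrt H k -> has_mean P k a ->
  {ae P, forall w, 0 < k w -> (v%:E <= Y w)%E} ->
  has_mean P (fun w => X w * k w) b -> v * a <= b.
Proof.
move=> X0 mX HY v0 k0 mk ka Yv [_ Xk].
have mkW := measurable_wrtW sH HW mk.
have [mY Y0 _] := HY; have mYW := measurable_wrtW sH HW mY.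
have XE0 w : (0 <= (EFin \o X) w)%E by rewrite lee_fin.
have mXE : measurable_fun setT (EFin \o X) by exact/measurable_EFinP.
rewrite -lee_fin -Xk.
rewrite [leRHS](_ : _ = \int[P]_w ((EFin \o X) w * (k w)%:E))%E//.
rewrite -(condexp_ge0_mulr sH HW XE0 mXE HY k0 mk).
have [_ <-] := has_meanZ v ka.
apply: ae_ge0_le_integral => //.
- by move=> w _; rewrite lee_fin mulr_ge0.
- by apply/measurable_EFinP; exact: measurable_funM.
- by move=> w _; rewrite mule_ge0// lee_fin.
- by apply: emeasurable_funM => //; exact/measurable_EFinP.
apply: filterS Yv => w h _; have := k0 w; rewrite le_eqVlt => /orP[/eqP <-|kp].
  by rewrite mulr0 mule0.
by rewrite EFinM lee_wpmul2r ?lee_fin// h.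
Qed.

End ConditionalMean.

(** * Drift of the truncated gradient noise *)

Section Drift.
Context {d} {W : measurableType d} {R : realType} (P : probability W R).
Context {m n : nat}.
Variable H : set (set W).
Hypotheses (sH : sigma_algebra [set: W] H) (HW : H `<=` @measurable d W).
Variables (A : set W) (g G : W -> 'M[R]_(m, n)) (gam b V M delta : R).
Hypotheses (mA : @measurable _ (g_sigma_algebraType H) A)
  (mg : measurable_mx_wrt H g) (g_le : forall w, frob_norm (g w) <= gam)
  (gA : forall w, ~ A w -> g w = 0) (mG : entry_measurable G).
Hypotheses (gam0 : 0 <= gam) (b0 : 0 <= b) (V0 : 0 < V) (M0 : 0 < M) (delta01 :
  0 < delta < 1).
Variables (Y : 'I_m -> 'I_n -> W -> \bar R) (Y2 Y1 : W -> \bar R).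
Hypotheses
  (condY : forall i j, condexp P H (fun w => G w i j) (Y i j))
  (biasY : {ae P, forall w, A w ->
     frob_norm (\matrix_(i, j) fine (Y i j w) - g w) <= b})
  (condY2 : condexp_ge0 P H (fun w => (frob_norm (G w) ^+ 2)%:E) Y2)
  (momentY2 : {ae P, forall w, A w -> (Y2 w <= V%:E)%E})
  (condY1 : condexp_ge0 P H
     (fun w => (\1_[set v | frob_norm (G v) <= M] w)%:E) Y1)
  (tailY1 : {ae P, forall w, A w -> ((1 - delta)%:E <= Y1 w)%E}).

Let good : W -> R := \1_[set v | frob_norm (G v) <= M].

Let mnG : measurable_fun [set: W] (fun w => frob_norm (G w)).
Proof. exact: measurable_frob_norm. Qed.

Let mgood : measurable_fun [set: W] good.
Proof.
apply: measurable_indic; apply: measurable_set_bool.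
exact: measurable_fun_ler.
Qed.

Let mnG2 : measurable_fun [set: W] (fun w => frob_norm (G w) ^+ 2).
Proof. by rewrite /=; exact: measurable_funX. Qed.

Let good01 w : (good w = 1 /\ frob_norm (G w) <= M) \/
  (good w = 0 /\ M < frob_norm (G w)).
Proof.
rewrite /good indicE; case: (boolP (w \in _)); rewrite ?inE ?notin_setE /= => h.
  by left.
by right; split => //; rewrite ltNge; apply/negP.
Qed.

Section Weight.
Variables (k : W -> R) (B : R).
Hypotheses (mk : measurable_wrt H k) (k0B : forall w, 0 <= k w <= B)
  (kA : forall w, ~ A w -> k w = 0).

Let k0 w : 0 <= k w. Proof. by case/andP: (k0B w). Qed.

Let mkW : measurable_fun [set: W] k.
Proof. exact: (measurable_wrtW sH HW mk). Qed.

Let kAP w : 0 < k w -> A w.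
Proof. by move=> kp; apply: contrapT => /kA k_eq0; rewrite k_eq0 ltxx in kp.
  Qed.

Let k_mean : exists a, has_mean P k a.
Proof.
apply: (@bounded_has_mean _ _ _ _ _ B) => // w.
by rewrite ger0_norm//; case/andP: (k0B w).
Qed.

Lemma mean_sqr_norm_le a : has_mean P k a ->
  exists2 c, has_mean P (fun w => frob_norm (G w) ^+ 2 * k w) c & c <= V * a.
Proof.
move=> ka; apply: (condexp_ge0_mean_le sH HW _ _ condY2 _ k0 mk ka) => //.
- by move=> w; exact: sqr_ge0.
- exact: ltW.
- by apply: filterS momentY2 => w + kp; apply; exact: kAP.
Qed.

Lemma mean_good_ge a c : has_mean P k a -> has_mean P (fun w => good w * k w) c
  ->
  (1 - delta) * a <= c.
Proof.
move=> ka; apply: (condexp_ge0_mean_ge sH HW _ _ condY1 _ k0 mk ka) => //.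
- by rewrite subr_ge0 ltW//; case/andP: delta01.
- by apply: filterS tailY1 => w + kp; apply; exact: kAP.
Qed.

(** Domination by [|G i j| <= 1 + |G|^2] makes the weighted entry integrable, as the conditional
    second moment is at most [V] on the support of [k]. *)
Lemma mean_entry i j : exists a,
  has_mean P (fun w => G w i j * k w) a /\
  has_mean P (fun w => fine (Y i j w) * k w) a.
Proof.
have [a ka] := k_mean; have [c kc _] := mean_sqr_norm_le ka.
have [c' [ci _]] : exists c', has_mean P (fun w => k w + frob_norm (G w) ^+ 2 *
  k w) c'.
  by exists (a + c); exact: has_meanD.
have [a' ha'] : exists a', has_mean P (fun w => G w i j * k w) a'.
  apply: integrable_has_mean; apply: le_integrable ci => //.
    by apply/measurable_EFinP; apply: measurable_funM => //; exact: mG.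
  move=> w _; rewrite lee_fin /= normrM (ger0_norm (k0 w)).
  rewrite [leRHS]ger0_norm; last by rewrite addr_ge0// mulr_ge0// sqr_ge0.
  apply: (@le_trans _ _ ((1 + frob_norm (G w) ^+ 2) * k w)); last first.
    by rewrite mulrDl mul1r.
  rewrite ler_wpM2r//.
  apply: le_trans (normr_entry_le _ i j) _.
  have := frob_norm_ge0 (G w); nra.
by exists a'; split => //; exact: (condexp_mulr sH HW (condY i j) (mG i j) k0
  mk ha').
Qed.

End Weight.

(** [condexp_mulr] takes non-negative weights, while [g i j] has a sign: [h * g i j] is split as
    [h * (g i j + gam) - h * gam]. *)
Lemma mean_entry_signed (h : W -> R) (B : R) i j :
  measurable_wrt H h -> (forall w, 0 <= h w <= B) ->
  (forall w, ~ A w -> h w = 0) ->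
  exists a, has_mean P (fun w => h w * (g w i j * G w i j)) a /\
    has_mean P (fun w => h w * (g w i j * fine (Y i j w))) a.
Proof.
move=> mh h0B hA.
have gij w : `|g w i j| <= gam by exact: le_trans (normr_entry_le _ i j) (g_le
  w).
have mhc (q : W -> R) : measurable_wrt H q -> measurable_wrt H (fun w => h w *
  q w).
  by move=> mq; exact: (@measurable_funM _ (g_sigma_algebraType H)).
have mc : measurable_wrt H (cst gam) by exact: measurable_cst.
have [||| a1 [G1 F1]] := @mean_entry (fun w => h w * (g w i j + gam)) (B * (gam
  + gam)) _ _ _ i j.
- apply: mhc; apply: (@measurable_funD _ (g_sigma_algebraType H)) => //.
  exact: mg.
- move=> w; have /andP[hw0 hwB] := h0B w.
  have := gij w; rewrite ler_norml => /andP[gl gu].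
  rewrite mulr_ge0 ?ler_pM//=; lra.
- by move=> w /hA ->; rewrite mul0r.
have [||| a2 [G2 F2]] := @mean_entry (fun w => h w * gam) (B * gam) _ _ _ i j.
- exact: mhc.
- move=> w; have /andP[hw0 hwB] := h0B w.
  by rewrite mulr_ge0 ?ler_pM//=.
- by move=> w /hA ->; rewrite mul0r.
exists (a1 - a2); split.
- by apply: has_mean_eq (has_meanB G1 G2) _ => w /=; ring.
- by apply: has_mean_eq (has_meanB F1 F2) _ => w /=; ring.
Qed.

(** The point is that both means are the same number: against an [H]-measurable matrix, [G] can be
    exchanged for its conditional mean. *)
Lemma mean_frob_inner (h : W -> R) (B : R) :
  measurable_wrt H h -> (forall w, 0 <= h w <= B) ->
  (forall w, ~ A w -> h w = 0) ->
  exists a, has_mean P (fun w => h w * frob_inner (g w) (G w)) a /\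
    has_mean P (fun w => h w *
      frob_inner (g w) (\matrix_(i, j) fine (Y i j w))) a.
Proof.
move=> mh h0B hA.
have /choice[a ha] : forall i, exists ai : 'I_n -> R, forall j,
    has_mean P (fun w => h w * (g w i j * G w i j)) (ai j) /\
    has_mean P (fun w => h w * (g w i j * fine (Y i j w))) (ai j).
  move=> i; have /choice[ai hai] : forall j, exists c,
      has_mean P (fun w => h w * (g w i j * G w i j)) c /\
      has_mean P (fun w => h w * (g w i j * fine (Y i j w))) c.
    by move=> j; exact: mean_entry_signed mh h0B hA.
  by exists ai.
exists (\sum_i \sum_j a i j); split.
- apply: (@has_mean_eq _ _ _ _ (fun w => \sum_i \sum_j h w * (g w i j * G w i
  j))).
    by apply: has_mean_sum => i; apply: has_mean_sum => j; case: (ha i j).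
  move=> w; rewrite frob_innerE mulr_sumr; apply: eq_bigr => i _.
  by rewrite mulr_sumr.
- apply: (@has_mean_eq _ _ _ _ (fun w => \sum_i \sum_j h w * (g w i j * fine (Y
  i j w)))).
    by apply: has_mean_sum => i; apply: has_mean_sum => j; case: (ha i j).
  move=> w; rewrite frob_innerE mulr_sumr; apply: eq_bigr => i _.
  by rewrite mulr_sumr; apply: eq_bigr => j _; rewrite mxE.
Qed.

Definition drift_increment w : R :=
  - frob_inner (g w) (\1_[set v | frob_norm (G v) <= M] w *: G w)
  + frob_norm (g w) ^+ 2 - (b + Num.sqrt (V * delta)) * frob_norm (g w).

Lemma normr_drift_increment_le w :
  `|drift_increment w| <= gam * M + gam ^+ 2 + (b + Num.sqrt (V * delta)) * gam.
Proof.
have beta0 : 0 <= b + Num.sqrt (V * delta) by rewrite addr_ge0// sqrtr_ge0.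
have g0 := frob_norm_ge0 (g w); have gl := g_le w.
apply: le_trans (ler_normB _ _) _; apply: lerD.
  apply: le_trans (ler_normD _ _) _; apply: lerD; last first.
    by rewrite ger0_norm ?sqr_ge0// lerXn2r ?nnegrE.
  rewrite normrN (le_trans (normr_frob_inner_le _ _))// ler_pM ?frob_norm_ge0//.
  rewrite frob_normZ -/(good w); have [[-> h]|[-> _]] := good01 w.
    by rewrite normr1 mul1r.
  by rewrite normr0 mul0r ltW.
by rewrite ger0_norm ?mulr_ge0// ler_wpM2l.
Qed.

(** [H'] will be [F t.+1], which sees [G t], whereas the drift is taken given [H = F t]. *)
Lemma measurable_drift_increment (H' : set (set W)) : sigma_algebra [set: W] H'
  ->
  measurable_mx_wrt H' g -> measurable_mx_wrt H' G ->
  measurable_wrt H' drift_increment.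
Proof.
move=> sH' mg' mG'; pose T' := g_sigma_algebraType H'.
have mng : measurable_wrt H' (fun w => frob_norm (g w)).
  exact: (@measurable_frob_norm _ T').
apply: (@measurable_funB _ T').
  apply: (@measurable_funD _ T').
    apply: (@measurable_funN _ T').
    apply: (@measurable_frob_inner _ T') => //.
    apply: (@entry_measurableZ _ T') => //.
    apply: (@measurable_indic _ T'); apply: (@measurable_set_bool _ T').
    apply: (@measurable_fun_ler _ T'); last exact: measurable_cst.
    exact: (@measurable_frob_norm _ T').
  exact: (@measurable_funX _ T').
apply: (@measurable_funM _ T') => //; exact: measurable_cst.
Qed.

(** Truncation changes [- <g, G>] by at most [|g| |G|] on the event [|G| > M], and there
    [|G| <= kappa/2 |G|^2 + 1/(2 kappa)]. The second moment bound and the tail bound turn this into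
    [(kappa V + delta/kappa)/2 = sqrt (V delta)] times the mean of [h |g|]; the oracle bias
    contributes [b] times the same mean. *)
Lemma drift_increment_mean_le0 (h : W -> R) (B : R) :
  measurable_wrt H h -> (forall w, 0 <= h w <= B) ->
  (\int[P]_w (h w * drift_increment w)%:E <= 0)%E.
Proof.
move=> mh h0B.
(* The increment vanishes off [A], so the weight may be cut to [A], where the noise bounds hold. *)
pose hA w := h w * \1_A w.
have hA0B w : 0 <= hA w <= B.
  have /andP[h0 hB] := h0B w; rewrite /hA indicE; case: (w \in A).
    by rewrite mulr1 h0.
  by rewrite mulr0 lexx (le_trans h0).
have mhA : measurable_wrt H hA.
  by apply: (@measurable_funM _ (g_sigma_algebraType H)) => //;
    exact: measurable_indic.
have hAA w : ~ A w -> hA w = 0.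
  by move=> nA; rewrite /hA indicE memNset// mulr0.
have hAg w (r : R) : (~ A w -> r = 0) -> h w * r = hA w * r.
  move=> r0; rewrite /hA indicE; case: (boolP (w \in A));
    first by rewrite mulr1.
  by rewrite notin_setE => /r0 ->; rewrite !mulr0.
have mng : measurable_wrt H (fun w => frob_norm (g w)).
  by apply: (@measurable_frob_norm _ (g_sigma_algebraType H)).
have ng0 w : 0 <= frob_norm (g w) by exact: frob_norm_ge0.
(* Every error is proportional to [|g|]; with this factor in the weight, all of them become
   multiples of the single mean [a] of [k]. *)
pose k w := hA w * frob_norm (g w).
have mk : measurable_wrt H k by exact: (@measurable_funM _ (g_sigma_algebraType
  H)).
have k0B w : 0 <= k w <= B * gam.
  by have /andP[h0 hB] := hA0B w; rewrite mulr_ge0//= ler_pM.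
have kA w : ~ A w -> k w = 0 by move=> /hAA h0; rewrite /k h0 mul0r.
have k_ge0 w : 0 <= k w by case/andP: (k0B w).
have bnd (q : W -> R) (C : R) : measurable_wrt H q -> (forall w, 0 <= q w <= C)
  ->
    exists a, has_mean P q a.
  move=> mq qC; apply: (@bounded_has_mean _ _ _ _ _ C).
    exact: (measurable_wrtW sH HW mq).
  by move=> w; have /andP[q0 ?] := qC w; rewrite ger0_norm.
have [a ka] := bnd _ _ mk k0B.
have [sq gsq] : exists a, has_mean P (fun w => k w * frob_norm (g w)) a.
  apply: (bnd _ (B * gam * gam)).
    exact: (@measurable_funM _ (g_sigma_algebraType H)).
  by move=> w; have /andP[h0 hB] := k0B w; rewrite mulr_ge0//= ler_pM.
have [c kc c_le] := mean_sqr_norm_le mk k0B kA ka.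
have [e ke] : exists e, has_mean P (fun w => good w * k w) e.
  apply: (@bounded_has_mean _ _ _ _ _ (B * gam)).
    by apply: measurable_funM => //; exact: (measurable_wrtW sH HW mk).
  move=> w; have /andP[h0 hB] := k0B w.
  by have [[-> _]|[-> _]] := good01 w; rewrite ?mul1r ?mul0r ?normr0
    ?ger0_norm// (le_trans h0).
have e_ge := mean_good_ge mk k0B kA ka ke.
have [s [gG gY]] := mean_frob_inner mhA hA0B hAA.
have delta0 : 0 < delta by case/andP: delta01.
(* AM-GM weight balancing [kappa V] against [delta / kappa] *)
pose kappa := Num.sqrt (V * delta) / V.
have sVd : 0 < Num.sqrt (V * delta) by rewrite sqrtr_gt0 mulr_gt0.
have kap0 : 0 < kappa by rewrite divr_gt0.
have kapV : kappa * V = Num.sqrt (V * delta) by rewrite /kappa divfK// gt_eqF.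
have kapd : kappa^-1 * delta = Num.sqrt (V * delta).
  apply: (@mulfI _ kappa); first by rewrite gt_eqF.
  rewrite mulrA mulfV ?gt_eqF// mul1r /kappa mulrAC -expr2 sqr_sqrtr ?mulr_ge0
    ?ltW//.
  by rewrite mulrAC mulfV ?gt_eqF// mul1r.
(* The bias bound in the form [<g, E[G|H]> >= |g|^2 - b |g|]. *)
have s_ge : sq - b * a <= s.
  apply: has_mean_le (has_meanB gsq (has_meanZ b ka)) gY _.
  apply: filterS biasY => w bias.
  have [Aw|nAw] := pselect (A w); last by rewrite kA// hAA// !mul0r mulr0 subr0.
  rewrite [leLHS](_ : _ = hA w * (frob_norm (g w) ^+ 2 - b * frob_norm (g w)));
    last first.
    by rewrite /k; ring.
  have /andP[h0 _] := hA0B w; rewrite ler_wpM2l//.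
  set y := \matrix_(i, j) _.
  have -> : y = (y - g w) + g w by rewrite subrK.
  rewrite frob_innerDr -frob_norm_sqr addrC lerD2r lerNl -frob_innerNl.
  apply: le_trans (frob_inner_le_norm _ _) _.
  by rewrite frob_normN mulrC ler_wpM2r// bias.
(* A majorant of [h * drift_increment] that is linear in quantities whose means are already known or
   bounded. *)
pose U w := - 1 * (hA w * frob_inner (g w) (G w))
  + kappa / 2 * (frob_norm (G w) ^+ 2 * k w)
  + kappa^-1 / 2 * (k w - good w * k w)
  + k w * frob_norm (g w) - (b + Num.sqrt (V * delta)) * k w.
have UE := has_meanB (has_meanD (has_meanD (has_meanD (has_meanZ (-1) gG)
  (has_meanZ (kappa / 2) kc)) (has_meanZ (kappa^-1 / 2) (has_meanB ka ke))) gsq)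
  (has_meanZ (b + Num.sqrt (V * delta)) ka).
have mD : measurable_fun setT drift_increment.
  have mgW : entry_measurable g by move=> i j; exact: (measurable_wrtW sH HW
    (mg i j)).
  apply: measurable_funB; last by apply: measurable_funM => //;
    exact: measurable_frob_norm.
  apply: measurable_funD; last by apply: measurable_funX;
    exact: measurable_frob_norm.
  apply: measurable_funN.
  by apply: measurable_frob_inner => //; exact: entry_measurableZ.
have mhW : measurable_fun setT h by exact: (measurable_wrtW sH HW mh).
have [u hu] : exists u, has_mean P (fun w => h w * drift_increment w) u.
  apply: (@bounded_has_mean _ _ _ _ _ (B * (gam * M + gam ^+ 2 + (b + Num.sqrt
    (V * delta)) * gam))).
    exact: measurable_funM.
  move=> w; have /andP[h0 hB] := h0B w.
  by rewrite normrM (ger0_norm h0) ler_pM// normr_drift_increment_le.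
have [_ ->] := hu; rewrite lee_fin.
apply: le_trans (has_mean_le hu UE _) _.
  apply: aeW => w.
  rewrite hAg; last first.
    move=> /gA g0; rewrite /drift_increment g0 -(scale0r (G w)) frob_innerZl
      mul0r.
    by rewrite frob_normZ normr0 mul0r oppr0 expr0n/= add0r mulr0 subr0.
  have /andP[h0 _] := hA0B w.
  have key : - frob_inner (g w) (good w *: G w) <= - frob_inner (g w) (G w)
     + frob_norm (g w) * (kappa / 2 * frob_norm (G w) ^+ 2 + kappa^-1 / 2 * (1
       - good w)).
    rewrite frob_innerZr; have [[-> _]|[-> _]] := good01 w.
      rewrite mul1r subrr mulr0 addr0 lerDl mulr_ge0//.
      by rewrite mulr_ge0 ?sqr_ge0// divr_ge0// ltW.
    rewrite mul0r oppr0 addr0 mulr1 addrC subr_ge0.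
    apply: le_trans (frob_inner_le_norm _ _) _; rewrite ler_wpM2l//.
    (* AM-GM after multiplication by [kappa]: the difference is the square
       [(kappa |G| - 1)^2 / 2]. *)
    rewrite -(ler_pM2l kap0) -subr_ge0.
    rewrite [leRHS](_ : _ = (kappa * frob_norm (G w) - 1) ^+ 2 / 2); last first.
      by field; rewrite gt_eqF.
    by rewrite divr_ge0// sqr_ge0.
  rewrite /drift_increment -/good -/(good w).
  apply: (@le_trans _ _ (hA w * (- frob_inner (g w) (G w)
     + frob_norm (g w) * (kappa / 2 * frob_norm (G w) ^+ 2 + kappa^-1 / 2 * (1
       - good w))
     + frob_norm (g w) ^+ 2 - (b + Num.sqrt (V * delta)) * frob_norm (g w)))).
    by rewrite ler_wpM2l// lerD2r lerD2r.
  by rewrite le_eqVlt; apply/orP; left; apply/eqP; rewrite /k; ring.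
have c_le' : kappa / 2 * c <= kappa / 2 * (V * a).
  by rewrite ler_wpM2l// divr_ge0// ltW.
have e_ge' : kappa^-1 / 2 * (a - e) <= kappa^-1 / 2 * (delta * a).
  rewrite ler_wpM2l//; first by rewrite divr_ge0// invr_ge0 ltW.
  by move: e_ge; lra.
have E1 : kappa / 2 * (V * a) = Num.sqrt (V * delta) * a / 2 by rewrite -kapV;
  ring.
have E2 : kappa^-1 / 2 * (delta * a) = Num.sqrt (V * delta) * a / 2.
  by rewrite -kapd; ring.
rewrite E1 in c_le'; rewrite E2 in e_ge'.
rewrite mulrDl; move: c_le' e_ge' s_ge.
set x1 := kappa / 2 * c; set x2 := kappa^-1 / 2 * _; set x3 := Num.sqrt _ * a.
lra.
Qed.

End Drift.

(** * The deterministic recursion *)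

Section Recursion.
Context {R : realType}.
Implicit Types (mu N q kap E : R) (D x : nat -> R).

(** With [tau = N + t], multiplication by [tau (tau - 1)] turns [1 - 2/tau] into
    [(tau - 1)(tau - 2)], the preceding weight. The increment of the weight is [2 (tau - 1)],
    exactly the coefficient of [q], so the [q] terms telescope too; the curvature term becomes at
    most [kap] per step. *)
Lemma unroll_recursion mu N q kap D x t :
  0 < mu -> 4 <= N -> 0 <= kap ->
  (forall s, (s < t)%N ->
    D s.+1 <= (1 - 2 / (N + s%:R)) * D s
      + 2 / (mu * (N + s%:R)) * (mu * q + x s) + kap / (N + s%:R) ^+ 2) ->
  (N + t%:R - 1) * (N + t%:R - 2) * D t <=
  (N - 1) * (N - 2) * D 0
  + q * ((N + t%:R - 1) * (N + t%:R - 2) - (N - 1) * (N - 2))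
  + 2 / mu * (\sum_(s < t) (N + s%:R - 1) * x s) + kap * t%:R.
Proof.
move=> mu0 N4 kap0; elim: t => [|t IH] rec.
  by rewrite big_ord0 !addr0 subrr !mulr0 !addr0.
have {}IH := IH (fun s st => rec s (ltnW st)).
have {rec} := rec t (ltnSn t).
rewrite big_ord_recr/= -(natr1 t).
have : 0 <= t%:R :> R by exact: ler0n.
move: IH; set S := \sum_(s < t) _; set w := t%:R; set d' := D t.+1;
  set d := D t.
move=> IH w0 rec.
have tp : 0 < N + w by lra.
have : (N + w) * (N + w - 1) * d' <= (N + w) * (N + w - 1) *
    ((1 - 2 / (N + w)) * d + 2 / (mu * (N + w)) * (mu * q + x t) + kap / (N +
      w) ^+ 2).
  by rewrite ler_wpM2l// mulr_ge0; lra.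
have -> : (N + w) * (N + w - 1) *
    ((1 - 2 / (N + w)) * d + 2 / (mu * (N + w)) * (mu * q + x t) + kap / (N +
      w) ^+ 2)
  = (N + w - 1) * (N + w - 2) * d + 2 * q * (N + w - 1) + 2 / mu * ((N + w - 1)
    * x t)
    + kap * ((N + w - 1) / (N + w)).
  by field; rewrite !gt_eqF.
have : kap * ((N + w - 1) / (N + w)) <= kap.
  by rewrite -[leRHS]mulr1 ler_wpM2l// ler_pdivrMr//; lra.
rewrite (_ : N + (w + 1) - 1 = N + w); last by ring.
rewrite (_ : N + (w + 1) - 2 = N + w - 1); last by ring.
move: IH; set im := 2 / mu; set y5 := _ / (N + w).
move=> h1 h2 h3; nra.
Qed.

(** After division by the weight, the initial gap, the noise and the curvature are at most [1],
    [2/11] and [1/2] times [E * sqrt (N / (N + t))], and their sum is below [2]. *)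
Lemma gap_rate mu N q kap E Dt S t :
  0 < mu -> 4 <= N -> 0 <= q -> 0 < E -> kap <= N * E / 4 ->
  S <= mu * E * Num.sqrt N * Num.sqrt t%:R * (N + t%:R - 2) / 11 ->
  (N + t%:R - 1) * (N + t%:R - 2) * Dt <=
  (N - 1) * (N - 2) * E
  + q * ((N + t%:R - 1) * (N + t%:R - 2) - (N - 1) * (N - 2))
  + 2 / mu * S + kap * t%:R ->
  Dt <= q + 2 * E * Num.sqrt N / Num.sqrt (N + t%:R).
Proof.
move=> mu0 N4 q0 E_gt0 kapN SN main.
have w0 : 0 <= t%:R :> R by exact: ler0n.
set w := t%:R in SN main w0 *; set tau := N + w in SN main *.
have tau4 : 4 <= tau by rewrite /tau; lra.
have taup : 0 < tau by lra.
pose u := Num.sqrt tau; have u0 : 0 < u by rewrite sqrtr_gt0.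
have uE : u * u = tau by rewrite -expr2 sqr_sqrtr// ltW.
pose n := Num.sqrt N; have n0 : 0 < n by rewrite sqrtr_gt0; lra.
have nE : n * n = N by rewrite -expr2 sqr_sqrtr//; lra.
pose v := Num.sqrt w; have v0 : 0 <= v by exact: sqrtr_ge0.
have vE : v * v = w by rewrite -expr2 sqr_sqrtr.
rewrite -/u -/n -/v in SN *.
have nu : n <= u by apply: ler_wsqrtr; rewrite /tau; lra.
(* [rho] is the target rate [sqrt (N / tau)]. Since [rho <= 1] and [N = rho^2 tau], each use of
   [N <= rho tau] yields one factor of the rate. *)
pose rho := n / u.
have rho0 : 0 < rho by rewrite divr_gt0.
have rho1 : rho <= 1 by rewrite ler_pdivrMr// mul1r.
have nrho : n = rho * u by rewrite divfK// gt_eqF.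
have Nrho : N = rho * rho * tau by rewrite -nE nrho -uE; ring.
(* By squaring: [tau t = tau (tau - N) <= tau (tau - 4) <= (tau - 1)^2]. *)
have uv : u * v <= tau - 1.
  rewrite -ler_sqr ?nnegrE ?mulr_ge0 ?(ltW u0)//; last by lra.
  rewrite exprMn !expr2 uE vE.
  have wE : w = tau - N by rewrite /tau; ring.
  have : tau * w <= tau * (tau - 4) by rewrite ler_wpM2l ?(ltW taup)//; lra.
  nra.
have SN2 : 2 / mu * S <= E * (2 / 11 * (rho * ((tau - 1) * (tau - 2)))).
  have : 2 / mu * S <= 2 / mu * (mu * E * n * v * (tau - 2) / 11).
    by rewrite ler_wpM2l// divr_ge0// ltW.
  move/le_trans; apply.
  rewrite [leLHS](_ : _ = E * (2 / 11 * (rho * ((u * v) * (tau - 2)))));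
    last first.
    by rewrite nrho; field; rewrite gt_eqF.
  rewrite ler_pM2l// ler_pM2l; last by lra.
  by rewrite ler_pM2l// ler_wpM2r//; lra.
have T1 : (N - 1) * (N - 2) <= rho * ((tau - 1) * (tau - 2)).
  rewrite mulrA; have rt : N - 1 <= rho * (tau - 1).
    have : rho * rho * tau <= rho * tau by rewrite ler_wpM2r ?(ltW taup)//
      -[leRHS]mulr1 ler_pM2l.
    by rewrite -Nrho; nra.
  apply: ler_pM; rewrite ?subr_ge0; [lra|lra|exact: rt|rewrite /tau; lra].
(* Here [tau >= 4] gives [tau <= 2 (tau - 2)], and this [2] turns the [1/4] of [kap] into [1/2]. *)
have T3 : kap * w <= E * (2^-1 * (rho * ((tau - 1) * (tau - 2)))).
  have : kap * w <= N * E / 4 * w by rewrite ler_wpM2r.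
  move/le_trans; apply.
  have Nt : N <= rho * tau.
    by rewrite Nrho ler_wpM2r ?(ltW taup)// -[leRHS]mulr1 ler_pM2l.
  have wt : w <= tau - 1 by rewrite /tau; lra.
  rewrite [leLHS](_ : _ = E * (4^-1 * (N * w))); last by field.
  rewrite ler_pM2l//.
  have : N * w <= rho * tau * (tau - 1) by apply: ler_pM => //; lra.
  have : rho * tau * (tau - 1) <= 2 * (rho * ((tau - 1) * (tau - 2))).
    rewrite [leRHS](_ : _ = rho * (2 * (tau - 2)) * (tau - 1)); last by ring.
    rewrite ler_wpM2r//; first by lra.
    rewrite ler_pM2l//; lra.
  by lra.
have prod0 : 0 < (tau - 1) * (tau - 2) by rewrite mulr_gt0//; lra.
rewrite -(ler_pM2l prod0).
have -> : (tau - 1) * (tau - 2) * (q + 2 * E * n / u) =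
    q * ((tau - 1) * (tau - 2)) + E * (2 * (rho * ((tau - 1) * (tau - 2)))).
  by rewrite /rho; field; rewrite gt_eqF.
apply: le_trans main _.
have q1 : 0 <= q * ((N - 1) * (N - 2)).
  by rewrite mulr_ge0// mulr_ge0//; lra.
have T1' : (N - 1) * (N - 2) * E <= E * (rho * ((tau - 1) * (tau - 2))).
  by rewrite mulrC ler_pM2l.
have pos : 0 <= E * (rho * ((tau - 1) * (tau - 2))).
  by rewrite mulr_ge0 ?(ltW E_gt0)// mulr_ge0 ?(ltW rho0)// ltW.
move: T1' SN2 T3 q1 pos; rewrite mulrBr.
set y := (tau - 1) * (tau - 2); set z := rho * y; set a4 := _ / mu * S.
lra.
Qed.

End Recursion.

(** * Spectral radius and decay of matrix powers *)

Section GeometricDecay.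
Context {C : numClosedFieldType}.

(** The constant [c' = |u 0| + c / (theta - |z|)] is preserved by induction because
    [c + |z| c' <= theta c']; this uses the strict inequality [|z| < theta]. *)
Lemma geometric_decay_step (u : nat -> C) (z theta c : C) :
  0 <= c -> `|z| < theta ->
  (forall k, `|u k.+1 - z * u k| <= c * theta ^+ k) ->
  exists2 c', 0 <= c' & forall k, `|u k| <= c' * theta ^+ k.
Proof.
move=> c0 zt h; have t0 : 0 < theta by exact: le_lt_trans zt.
have tz : 0 < theta - `|z| by rewrite subr_gt0.
pose c' := `|u 0%N| + c / (theta - `|z|).
have c'0 : 0 <= c' by rewrite addr_ge0// divr_ge0// ltW.
exists c' => //; elim=> [|k IH].
  by rewrite expr0 mulr1 lerDl divr_ge0// ltW.
rewrite -(subrK (z * u k) (u k.+1)).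
apply: le_trans (ler_normD _ _) _.
apply: (@le_trans _ _ (c * theta ^+ k + `|z| * (c' * theta ^+ k))).
  by apply: lerD => //; rewrite normrM ler_wpM2l.
rewrite exprS !mulrA -mulrDl ler_wpM2r ?exprn_ge0 ?(ltW t0)//.
rewrite -lerBrDr [c' * _]mulrC -mulrBl -ler_pdivrMl//.
by rewrite mulrC lerDr.
Qed.

(* By Cayley-Hamilton [X ^+ k * prod (X - z)] vanishes; the linear factors are
   then stripped one at a time. *)
Lemma expmx_geometric_decay n (X : 'M[C]_n.+1) (theta : C) :
  0 <= theta -> (forall z, eigenvalue X z -> `|z| < theta) ->
  forall a b, exists2 c, 0 <= c & forall k, `|(X ^+ k) a b| <= c * theta ^+ k.
Proof.
move=> t0 ev a b.
pose e (p : {poly C}) k := horner_mx X ('X^k * p) a b.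
have strip (r : seq C) (q : {poly C}) : {in r, forall z, `|z| < theta} ->
    (exists2 c, 0 <= c & forall k,
      `|e (q * \prod_(z <- r) ('X - z%:P)) k| <= c * theta ^+ k) ->
    exists2 c, 0 <= c & forall k, `|e q k| <= c * theta ^+ k.
  elim: r q => [|z r IH] q rt; first by rewrite big_nil mulr1.
  rewrite big_cons mulrA => h.
  have [|c c0 hc] := IH (q * ('X - z%:P)) _ h.
    by move=> y yr; apply: rt; rewrite inE yr orbT.
  apply: (@geometric_decay_step (e q) z theta c) => //.
    by apply: rt; rewrite mem_head.
  move=> k; have := hc k; rewrite /e.
  (* A linear factor acts on the sequence of entries as [u k.+1 - z * u k], the shape
     [geometric_decay_step] expects. *)
  rewrite (_ : 'X^k * (q * ('X - z%:P)) = 'X^(k.+1) * q - z *: ('X^k * q));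
    last first.
    by rewrite exprSr -mul_polyC; ring.
  by rewrite linearB linearZ/= !mxE.
have [r rE] := closed_field_poly_normal (char_poly X).
rewrite (monicP (char_poly_monic X)) scale1r in rE.
have [||c c0 hc] := strip r 1.
- move=> z zr; apply: ev; rewrite eigenvalue_root_char rE.
  by rewrite root_prod_XsubC.
- exists 0 => // k.
  by rewrite mul1r -rE /e rmorphM/= Cayley_Hamilton mulr0 mxE normr0 mul0r.
exists c => // k; have := hc k.
by rewrite /e mulr1 rmorphXn/= horner_mx_X.
Qed.

End GeometricDecay.

(** [sup] bounds its set only if the set is bounded; the eigenvalues are the roots of the
    characteristic polynomial, and the sum of their moduli is an upper bound. *)
Lemma spectral_radius_ge (R : realType) n (X : 'M[R]_n) (l : R[i]) :
  eigenvalue (map_mx (real_complex R) X) l -> complex.Re `|l| <=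
    spectral_radius X.
Proof.
move=> el; apply: sup_ubound; last by exists l.
have [r rE] := closed_field_poly_normal (char_poly (map_mx (real_complex R) X)).
rewrite (monicP (char_poly_monic _)) scale1r in rE.
exists (\sum_(z <- r) complex.Re `|z|) => _ [z /= + <-].
rewrite eigenvalue_root_char rE root_prod_XsubC => zr.
rewrite (big_rem z)//= lerDl sumr_ge0// => y _.
by case: y => p q /=; exact: sqrtr_ge0.
Qed.

Lemma expmx_decay (R : realType) n (X : 'M[R]_n) : spectral_radius X < 1 ->
  exists theta c : R, [/\ 0 < theta < 1, 0 <= c &
    forall k i j, `|iter k (mulmx X) 1%:M i j| <= c * theta ^+ k].
Proof.
case: n X => [|n] X X1.
  exists 2^-1, 0; split=> //; last by move=> k [].
  by apply/andP; split; lra.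
(* The maximum ensures [0 < theta < 1] for the midpoint [theta] of [rho] and [1], which exceeds
   every eigenvalue modulus strictly. *)
pose rho := Num.max (spectral_radius X) 0.
have rho0 : 0 <= rho by rewrite le_max lexx orbT.
have rho1 : rho < 1 by rewrite gt_max X1 ltr01.
pose theta := (1 + rho) / 2.
have t0 : 0 < theta by rewrite /theta; lra.
have ev z : eigenvalue (map_mx (real_complex R) X) z -> `|z| < (theta%:C)%C.
  move=> /spectral_radius_ge; rewrite normc_def /= ltcR => zX.
  apply: le_lt_trans zX _; apply: (@le_lt_trans _ _ rho).
    by rewrite le_max lexx.
  by rewrite /theta; lra.
have t0C : 0 <= (theta%:C)%C by rewrite ler0c ltW.
have decay i j : exists2 c : R, 0 <= c & forall k, `|(X ^+ k) i j| <= c * theta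
  ^+ k.
  have [c c0 hc] := expmx_geometric_decay t0C ev i j.
  exists (Num.sqrt (complex.Re c ^+ 2 + complex.Im c ^+ 2));
    first exact: sqrtr_ge0.
  have cE : ((Num.sqrt (complex.Re c ^+ 2 + complex.Im c ^+ 2))%:C)%C = c.
    by rewrite -normc_def ger0_norm.
  move=> k; rewrite -lecR rmorphM rmorphXn /= cE.
  apply: le_trans (hc k).
  have -> : (map_mx (real_complex R) X ^+ k) i j = (((X ^+ k) i j)%:C)%C.
    by rewrite -(rmorphXn (map_mx (real_complex R))) mxE.
  exact: normc_ge_Re (((X ^+ k) i j)%:C)%C.
have /choice[c1 hc1] : forall i, exists c1 : 'I_n.+1 -> R, forall j,
    0 <= c1 j /\ forall k, `|(X ^+ k) i j| <= c1 j * theta ^+ k.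
  move=> i; have /choice[c1 h1] : forall j, exists c : R,
      0 <= c /\ forall k, `|(X ^+ k) i j| <= c * theta ^+ k.
    by move=> j; have [c ? ?] := decay i j; exists c.
  by exists c1.
have s0 i : 0 <= \sum_j c1 i j by apply: sumr_ge0 => j _; case: (hc1 i j).
exists theta, (\sum_i \sum_j c1 i j); split.
- by rewrite t0 /theta; lra.
- exact: sumr_ge0.
- move=> k i j.
  have -> : iter k (mulmx X) 1%:M = X ^+ k.
    by elim: k => //= k ->; rewrite exprS.
  have [_ /(_ k)/le_trans] := hc1 i j; apply.
  rewrite ler_wpM2r ?exprn_ge0 ?(ltW t0)//.
  rewrite (bigD1 i)//= (bigD1 j)//= -addrA lerDl addr_ge0//.
    by apply: sumr_ge0 => j' _; case: (hc1 i j').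
  by apply: sumr_ge0 => i' _.
Qed.

(** * Finite cost of stable policies *)

Section StableCost.
Context {R : realType} {n m : nat}.
Variables (A : 'M[R]_n) (B : 'M[R]_(n, m)) (Q : 'M[R]_n) (S : 'M[R]_m).
Hypotheses (Qpd : sym_posdef Q) (Spd : sym_posdef S).
Variable D : probability (borel_cV R n) R.

Lemma lqr_stateE K x0 i :
  lqr_state A B K x0 i = iter i (mulmx (A - B *m K)) 1%:M *m x0.
Proof.
elim: i => [|i IH] /=; first by rewrite mul1mx.
by rewrite IH /lqr_action mulmxN !mulmxA -!mulmxBl.
Qed.

Definition abs_sum p q (Z : 'M[R]_(p, q)) : R := \sum_i \sum_j `|Z i j|.

Lemma abs_sum_ge0 p q (Z : 'M[R]_(p, q)) : 0 <= abs_sum Z.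
Proof. by apply: sumr_ge0 => i _; exact: sumr_ge0. Qed.

Lemma row_abs_sum_le p q (Z : 'M[R]_(p, q)) i : \sum_j `|Z i j| <= abs_sum Z.
Proof.
by rewrite /abs_sum (bigD1 i)//= lerDl sumr_ge0// => i' _; exact: sumr_ge0.
Qed.

Lemma normr_mulmx_entry_le p q (Z : 'M[R]_(p, q)) (y : 'cV[R]_q) (a : R) i :
  0 <= a -> (forall j, `|y j 0| <= a) -> `|(Z *m y) i 0| <= abs_sum Z * a.
Proof.
move=> a0 ya; rewrite mxE; apply: le_trans (ler_norm_sum _ _ _) _.
apply: (@le_trans _ _ ((\sum_j `|Z i j|) * a)).
  by rewrite mulr_suml; apply: ler_sum => j _; rewrite normrM ler_wpM2l.
by rewrite ler_wpM2r// row_abs_sum_le.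
Qed.

Lemma quad_form_le p (Z : 'M[R]_p) (y : 'cV[R]_p) (a : R) :
  0 <= a -> (forall j, `|y j 0| <= a) -> quad_form Z y <= abs_sum Z * a ^+ 2.
Proof.
move=> a0 ya; rewrite /quad_form -mulmxA mxE /abs_sum mulr_suml.
apply: ler_sum => i _; rewrite !mxE expr2 mulrA.
apply: le_trans (ler_norm _) _; rewrite normrM mulrC ler_pM//.
apply: le_trans (ler_norm_sum _ _ _) _; rewrite mulr_suml.
by apply: ler_sum => j _; rewrite normrM ler_wpM2l.
Qed.

(** States are linear in [x0] and stage costs quadratic, so for almost every [x0] they lie below one
    geometric series of ratio [theta^2], uniformly in [x0]. *)
Lemma stable_lqr_cost_lt_pinfty DX K : initial_distribution D DX ->
  stable A B K -> (lqr_cost A B Q S D K < +oo)%E.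
Proof.
move=> [_ xDX] /expmx_decay[theta [c [/andP[t0 t1] c0 decay]]].
pose c1 : R := \sum_(i < n) \sum_(j < n) c.
have c10 : 0 <= c1 by apply: sumr_ge0 => i _; exact: sumr_ge0.
pose DXp := Num.max DX 0.
have DXp0 : 0 <= DXp by rewrite le_max lexx orbT.
pose c2 := (abs_sum Q + abs_sum S * abs_sum K ^+ 2) * (c1 * DXp) ^+ 2.
have c20 : 0 <= c2.
  rewrite mulr_ge0 ?sqr_ge0// addr_ge0 ?abs_sum_ge0//.
  by rewrite mulr_ge0 ?sqr_ge0// abs_sum_ge0.
have th2 : 0 < theta ^+ 2 < 1 by rewrite exprn_gt0//= expr2; nra.
have /andP[th20 th21] := th2.
have stage x i : frob_norm x <= DX ->
    lqr_stage_cost Q S K (lqr_state A B K x i) <= geometric c2 (theta ^+ 2) i.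
  move=> xD; set y := lqr_state A B K x i.
  pose a := c1 * theta ^+ i * DXp.
  have a0 : 0 <= a by rewrite mulr_ge0// mulr_ge0// exprn_ge0// ltW.
  have ya j : `|y j 0| <= a.
    rewrite /y lqr_stateE.
    apply: le_trans (normr_mulmx_entry_le _ _ DXp0 _) _.
      by move=> k; rewrite (le_trans (normr_entry_le _ k 0))// le_max xD.
    rewrite ler_wpM2r// /abs_sum /c1 mulr_suml; apply: ler_sum => k _.
    by rewrite mulr_suml; apply: ler_sum => l _; exact: decay.
  have Ka j : `|(lqr_action K y) j 0| <= abs_sum K * a.
    by rewrite /lqr_action mxE normrN; exact: normr_mulmx_entry_le.
  apply: (@le_trans _ _ (abs_sum Q * a ^+ 2 + abs_sum S * (abs_sum K * a) ^+
    2)).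
    apply: lerD; first exact: quad_form_le.
    by apply: quad_form_le => //; rewrite mulr_ge0// abs_sum_ge0.
  rewrite /geometric /= /c2 /a -exprM mulnC exprM le_eqVlt; apply/orP; left;
    apply/eqP.
  by ring.
apply: (@le_lt_trans _ _ (\int[D]_x (c2 * (1 - theta ^+ 2)^-1)%:E)%E);
  last first.
  rewrite integral_cst//= (_ : D setT = 1%E) ?mule1 ?ltry//;
    exact: probability_setT.
have bnd0 : 0 <= c2 * (1 - theta ^+ 2)^-1.
  by rewrite mulr_ge0// invr_ge0 subr_ge0 ltW.
apply: ae_ge0_le_integral => //.
- by move=> x _; apply: nneseries_ge0 => i _ _;
  rewrite lee_fin lqr_stage_cost_ge0.
- apply: (@measurable_lqr_path_cost _ _ _ A B Q S Qpd Spd _ _ (fun=> K)).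
    exact: entry_measurable_cst.
  exact: entry_measurable_borel_cV.
apply: (@filterS _ _ (ae_filter_ringOfSetsType D) _ _ _ xDX) => x xD _.
apply: lime_le.
  by apply: is_cvg_nneseries => i _ _; rewrite lee_fin lqr_stage_cost_ge0.
apply: nearW => N; rewrite sumEFin lee_fin.
apply: (@le_trans _ _ (series (geometric c2 (theta ^+ 2)) N)).
  by rewrite /series /=; apply: ler_sum => i _; exact: stage.
apply: geometric_le_lim => //.
by rewrite ger0_norm// ltW.
Qed.

End StableCost.

(** * Stochastic policy gradient *)

Section Descent.
Context {R : realType} {m n : nat}.
Variables (f : 'M[R]_(m, n) -> \bar R) (stab : 'M[R]_(m, n) -> Prop).
Variables (fstar mu : R) (L r : R -> R) (Dl : R).
Hypotheses (f_ge : forall K, (fstar%:E <= f K)%E)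
  (land : landscape_constants f stab fstar mu L r) (Dl0 : 0 < Dl).

Lemma gap_le_fin K c : (gap f fstar K <= c%:E)%E ->
  [/\ f K \is a fin_num, gap f fstar K = (fine (gap f fstar K))%:E,
      0 <= fine (gap f fstar K) & fine (gap f fstar K) <= c].
Proof.
rewrite /gap; have := f_ge K; case: (f K) => [x| |] //.
by rewrite -EFinB !lee_fin subr_ge0 => -> ->.
Qed.

Lemma gap_lt_fin K c : (gap f fstar K < c%:E)%E ->
  f K \is a fin_num /\ gap f fstar K = (fine (gap f fstar K))%:E.
Proof. by move/ltW/gap_le_fin => []. Qed.

Lemma landscape_upper_model K : (gap f fstar K < Dl%:E)%E ->
  has_upper_model f K (grad f K) (L Dl / 2) (r Dl).
Proof.
move=> KDl K' K'r; have [_ /(_ _ Dl0)[_ _ /(_ _ KDl)[h _ _]]] := land.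
by have [_] := h _ K'r.
Qed.

Lemma landscape_grad K : (gap f fstar K < Dl%:E)%E ->
  mu * fine (gap f fstar K) <= frob_norm (grad f K) ^+ 2 /\
  frob_norm (grad f K) ^+ 2 <= 2 * L Dl * fine (gap f fstar K).
Proof.
move=> KDl; have [_ /(_ _ Dl0)[_ _ /(_ _ KDl)[_ + +]]] := land.
by have [_ ->] := gap_lt_fin KDl; rewrite -!EFinM !lee_fin.
Qed.

Lemma gap_step_le K G M eta : (gap f fstar K < Dl%:E)%E ->
  frob_norm G <= M -> 0 <= eta -> eta * M <= r Dl ->
  (gap f fstar (K - eta *: G) <= (fine (gap f fstar K)
     - eta * frob_inner (grad f K) G + L Dl / 2 * (eta * M) ^+ 2)%:E)%E.
Proof.
move=> KDl GM eta0 etaM.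
have M0 : 0 <= M by exact: le_trans (frob_norm_ge0 G) GM.
have L0 : 0 < L Dl by have [_ /(_ _ Dl0)[]] := land.
have KK : K - eta *: G - K = - (eta *: G) by rewrite addrAC subrr add0r.
have nKK : frob_norm (K - eta *: G - K) = eta * frob_norm G.
  by rewrite KK frob_normN frob_normZ ger0_norm.
have etaG : eta * frob_norm G <= eta * M by rewrite ler_wpM2l.
have := landscape_upper_model KDl (K' := K - eta *: G).
rewrite (frob_normB K) nKK => /(_ (le_trans etaG etaM)).
rewrite KK (frob_innerC _ (- _)) frob_innerNl frob_innerC frob_innerZr.
have [fK _] := gap_lt_fin KDl; rewrite /gap -(fineK fK).
have := f_ge (K - eta *: G).
case: (f (K - eta *: G)) => [z| |] //.
rewrite -EFinB -EFinD -EFinB !lee_fin /= => _ h.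
have : L Dl / 2 * (eta * frob_norm G) ^+ 2 <= L Dl / 2 * (eta * M) ^+ 2.
  rewrite ler_wpM2l ?divr_ge0 ?(ltW L0)// lerXn2r ?nnegrE ?mulr_ge0//.
  exact: frob_norm_ge0.
by lra.
Qed.

End Descent.

Section SPG.
Context {R : realType} {m n : nat}.
Variables (f : 'M[R]_(m, n) -> \bar R) (stab : 'M[R]_(m, n) -> Prop).
Variables (fstar mu : R) (L r : R -> R).
Context {d : measure_display} {W : measurableType d}.
Variables (P : probability W R) (F : nat -> set (set W)).
Variables (G : nat -> W -> 'M[R]_(m, n)).
Variables (b : R -> R -> R) (V : R -> R) (M : R -> R -> R).
Variables (K0 : 'M[R]_(m, n)) (delta N : R).
(** Measurability of [f] is asked on every measurable type so that it applies to [W] equipped with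
    the smaller sigma-algebra [F t]. *)
Hypotheses (mf : forall d' (T : measurableType d') (X : T -> 'M[R]_(m, n)),
    entry_measurable X -> measurable_fun [set: T] (f \o X))
  (f_ge : forall K, (fstar%:E <= f K)%E)
  (land : landscape_constants f stab fstar mu L r)
  (Ffilt : filtration F)
  (mG : forall t, measurable_mx_wrt (F t.+1) (G t))
  (delta01 : 0 < delta < 1)
  (K0fin : (gap f fstar K0 < +oo)%E) (K0pos : (0 < gap f fstar K0)%E).

Let Delta0 := fine (gap f fstar K0).
Let Delta := 4 * Delta0.
Let LD := L Delta.
Let rD := r Delta.
Let bD := b Delta delta.
Let VD := V Delta.
Let MD := M Delta delta.
Let GD := 2 * Num.sqrt (LD * Delta).
Let beta := bD + Num.sqrt (VD * delta).
Let q := GD * beta / mu.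
Let eta t := 2 / (mu * (N + t%:R)).
Let K := spg_iterates K0 eta G.

Hypotheses (N4 : 4 <= N) (Nr : 2 * MD / (mu * rD) <= N)
  (Nln : 1024 * GD ^+ 2 * (MD + GD) ^+ 2 * ln (1 / delta)
            / (mu ^+ 2 * Delta0 ^+ 2) <= N)
  (NM : 8 * LD * MD ^+ 2 / (mu ^+ 2 * Delta0) <= N)
  (noise : noise_condition P f fstar F K G b V M)
  (q_le : q <= Delta0).

Let gapK0 : gap f fstar K0 = Delta0%:E.
Proof.
by rewrite /Delta0 fineK// ge0_fin_numE// ltW.
Qed.

Let Delta0_gt0 : 0 < Delta0.
Proof. by rewrite -lte_fin -gapK0. Qed.

Let Delta_gt0 : 0 < Delta. Proof. by rewrite mulr_gt0. Qed.

Let mu_gt0 : 0 < mu. Proof. by case: land. Qed.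

Let LD_gt0 : 0 < LD. Proof. by have [_ /(_ _ Delta_gt0)[]] := land. Qed.

Let rD_gt0 : 0 < rD. Proof. by have [_ /(_ _ Delta_gt0)[]] := land. Qed.

Let bD_ge0 : 0 <= bD. Proof. by have [] := noise Delta_gt0 delta01. Qed.

Let VD_gt0 : 0 < VD. Proof. by have [] := noise Delta_gt0 delta01. Qed.

Let MD_gt0 : 0 < MD. Proof. by have [] := noise Delta_gt0 delta01. Qed.

Let beta_ge0 : 0 <= beta. Proof. by rewrite addr_ge0// sqrtr_ge0. Qed.

Let GD_gt0 : 0 < GD.
Proof. by rewrite mulr_gt0// sqrtr_gt0 mulr_gt0. Qed.

Let GD_sqr : GD ^+ 2 = 16 * LD * Delta0.
Proof.
rewrite /GD exprMn sqr_sqrtr; last by rewrite mulr_ge0// ltW.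
by rewrite /Delta; ring.
Qed.

Let q_ge0 : 0 <= q.
Proof. by rewrite divr_ge0 ?mulr_ge0// ltW. Qed.

Let mu_le_LD : mu <= 2 * LD.
Proof.
have [|h1 h2] := landscape_grad f_ge land Delta_gt0 (K := K0).
  by rewrite gapK0 lte_fin /Delta; have := Delta0_gt0; lra.
by have := le_trans h1 h2; rewrite -/Delta0 ler_pM2r.
Qed.

(* The assumption [q <= Delta0] and [mu <= 2 LD] make the bias small compared
   with [GD]. *)
Let beta_le : beta <= GD / 8.
Proof.
have h : GD * beta <= mu * Delta0.
  by move: q_le; rewrite /q ler_pdivrMr// mulrC (mulrC mu).
have : GD * beta <= GD * (GD / 8).
  apply: le_trans h _; rewrite mulrA -expr2 GD_sqr.
  have : mu * Delta0 <= 2 * LD * Delta0 by rewrite ler_pM2r.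
  lra.
by rewrite ler_pM2l.
Qed.

(** At gap at most [3 Delta0], [|grad f|^2 <= 6 LD Delta0 = 3/8 GD^2], and [5/8] is a rational above
    [sqrt (3/8)]. *)
Let gam := 5 / 8 * GD.

Let gam_ge0 : 0 <= gam. Proof. by rewrite mulr_ge0// ltW. Qed.

Let A t : set W := [set w | (gap f fstar (K t w) <= (3 * Delta0)%:E)%E].

Let A_lt t w : A t w -> (gap f fstar (K t w) < Delta%:E)%E.
Proof. by move/le_lt_trans; apply; rewrite lte_fin /Delta; have := Delta0_gt0;
  lra. Qed.

Let g t w := \1_(A t) w *: grad f (K t w).

Let gE t w : A t w -> g t w = grad f (K t w).
Proof. by move=> Aw; rewrite /g indicE mem_set// scale1r. Qed.

Let g_out t w : ~ A t w -> g t w = 0.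
Proof. by move=> Aw; rewrite /g indicE memNset// scale0r. Qed.

Let g_le t w : frob_norm (g t w) <= gam.
Proof.
have [Aw|nA] := pselect (A t w); last first.
  by rewrite g_out// -(scale0r 0) frob_normZ normr0 mul0r.
rewrite gE// -ler_sqr ?nnegrE ?frob_norm_ge0//.
have [_ h] := landscape_grad f_ge land Delta_gt0 (A_lt Aw).
have [_ _ _ h3] := gap_le_fin f_ge Aw.
rewrite (le_trans h)// /gam exprMn GD_sqr -/LD.
have : 2 * LD * fine (gap f fstar (K t w)) <= 2 * LD * (3 * Delta0).
  by rewrite ler_wpM2l// mulr_ge0// ltW.
have : 0 < LD * Delta0 by rewrite mulr_gt0.
lra.
Qed.

Lemma spg_iterates_measurable t : measurable_mx_wrt (F t) (K t).
Proof.
elim: t => [|t IH]; first by move=> i j; exact: measurable_cst.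
have [sF FW FS] := Ffilt.
pose T' := g_sigma_algebraType (F t.+1).
apply: (@entry_measurableD _ T') => //.
  move=> i j; exact (@measurable_wrt_le _ _ F Ffilt t t.+1 _ _ _ (leqnSn t) (IH
    i j)).
apply: (@entry_measurableN _ T'); apply: (@entry_measurableZ _ T') => //.
exact: mG.
Qed.

Lemma gap_iterate_measurable t :
  measurable_wrt (F t) (fun w => gap f fstar (K t w)).
Proof.
pose T' := g_sigma_algebraType (F t).
apply: (@emeasurable_funB _ T'); last exact: measurable_cst.
exact: (@mf _ T' (K t) (@spg_iterates_measurable t)).
Qed.

Let mA t : @measurable _ (g_sigma_algebraType (F t)) (A t).
Proof.
rewrite -[A t]setTI.
apply: (@emeasurable_fun_infty_c _ (g_sigma_algebraType (F t))) => //.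
exact: gap_iterate_measurable.
Qed.

Let mg t : measurable_mx_wrt (F t) (g t).
Proof.
apply: (@entry_measurable_grad _ _ _ _ (g_sigma_algebraType (F t)) f (K t)
  (LD / 2) rD fstar (A t)) => //.
- exact: mf.
- exact: spg_iterates_measurable.
- by rewrite divr_ge0// ltW.
- move=> w Aw; have [fK _ _ _] := gap_le_fin f_ge Aw.
  by split => //; exact: landscape_upper_model land Delta_gt0 _ (A_lt Aw).
Qed.

Let mGW t : entry_measurable (G t).
Proof.
have [sF FW FS] := Ffilt.
by move=> i j; exact: (measurable_wrtW (sF t.+1) (FW t.+1) (@mG t i j)).
Qed.

(** The factor that the noise of step [t] carries in [unroll_recursion]. *)
Let wt t : R := N + t%:R - 1.

Let wt_ge0 t : 0 <= wt t.
Proof. have h := ler0n R t; have h4 := N4; rewrite /wt. lra. Qed.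

Let X t w := wt t * drift_increment (g t) (G t) bD VD MD delta w.

Let cG := GD * (MD + GD).

Let cG_gt0 : 0 < cG. Proof. by rewrite mulr_gt0// addr_gt0. Qed.

Let X_le t w : `|X t w| <= wt t * cG.
Proof.
rewrite normrM (ger0_norm (wt_ge0 t)) ler_wpM2l//.
apply: le_trans (normr_drift_increment_le (G t) VD delta (@g_le t) gam_ge0
  bD_ge0 MD_gt0 w) _.
rewrite -/beta /cG /gam.
have : beta * (5 / 8 * GD) <= GD / 8 * (5 / 8 * GD) by rewrite ler_wpM2r.
have : 0 < GD * MD by rewrite mulr_gt0.
have : 0 < GD * GD by rewrite mulr_gt0.
rewrite !expr2; nra.
Qed.

Let mX t : measurable_wrt (F t.+1) (X t).
Proof.
have [sF FW FS] := Ffilt.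
apply: (@measurable_funM _ (g_sigma_algebraType (F t.+1))) => //.
apply: measurable_drift_increment => //.
move=> i j; exact (@measurable_wrt_le _ _ F Ffilt t t.+1 _ _ _ (leqnSn t) (@mg
  t i j)).
Qed.

Let A_Delta t w : A t w -> (gap f fstar (K t w) <= Delta%:E)%E.
Proof. by move/A_lt/ltW. Qed.

Let drift t (h : W -> R) (B : R) :
  measurable_wrt (F t) h -> (forall w, 0 <= h w <= B) ->
  (\int[P]_w (h w * X t w)%:E <= 0)%E.
Proof.
move=> mh h0B; have [sF FW FS] := Ffilt.
have [_ _ _ /(_ t)[[Y condY biasY] [Y2 condY2 momY2] [Y1 condY1 tailY1]]] :=
  noise Delta_gt0 delta01.
pose h' w := wt t * h w.
rewrite (_ : (fun w => _) = (fun w => (h' w *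
    drift_increment (g t) (G t) bD VD MD delta w)%:E)); last first.
  by apply/funext => w; rewrite /h' /X mulrA (mulrC (wt t)).
apply: (@drift_increment_mean_le0 _ _ _ P _ _ (F t) (sF t) (FW t) (A t) (g t)
  (G t) gam bD VD MD delta (@mA t) (@mg t) (@g_le t) (@g_out t) (@mGW t) gam_ge0
  bD_ge0 VD_gt0 MD_gt0 delta01 Y Y2 Y1 condY _ condY2 _ condY1 _ h' (wt t * B)).
- by apply: filterS biasY => w H Aw; rewrite gE//; apply: H; exact: A_Delta.
- by apply: filterS momY2 => w H Aw; apply: H; exact: A_Delta.
- by apply: filterS tailY1 => w H Aw; apply: H; exact: A_Delta.
- exact: (@measurable_funM _ (g_sigma_algebraType (F t))).
- by move=> w; have /andP[h0 hB] := h0B w; rewrite mulr_ge0//= ler_wpM2l.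
Qed.

(** Restricted to [A t] because the tail bound on [G t] is available only there; the induction
    places the iterate in [A t] before the event is consulted. *)
Definition escape t : set W := A t `&` [set w | MD < frob_norm (G t w)].

Let mAW t : measurable (A t).
Proof.
have [sF FW _] := Ffilt; apply: (FW t); apply: (measurable_wrtE (sF t)).
exact: mA.
Qed.

Let mnG t : measurable_fun [set: W] (fun w => frob_norm (G t w)).
Proof. exact: measurable_frob_norm. Qed.

Lemma measurable_escape t : measurable (escape t).
Proof.
apply: measurableI => //; apply: measurable_set_bool.
exact: measurable_fun_ltr.
Qed.

Lemma escape_prob t : (P (escape t) <= delta%:E)%E.
Proof.
have [sF FW FS] := Ffilt.
have [_ _ _ /(_ t)[_ _ [Y1 condY1 tailY1]]] := noise Delta_gt0 delta01.
have mk : measurable_wrt (F t) (\1_(A t) : W -> R) by exact: measurable_indic.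
have mkW : measurable_fun setT (\1_(A t) : W -> R) by exact: measurable_indic.
have mgood : measurable [set w | frob_norm (G t w) <= MD].
  by apply: measurable_set_bool; exact: measurable_fun_ler.
have k01 w : 0 <= (\1_(A t) w : R) <= 1 by rewrite indicE; case: (_ \in _);
  rewrite ?lexx ?ler01.
have [a ka] : exists a, has_mean P (\1_(A t)) a.
  by apply: (@bounded_has_mean _ _ _ _ _ 1) => // w; have /andP[? ?] := k01 w;
    rewrite ger0_norm.
have [c kc] : exists c, has_mean P
    (fun w => \1_[set v | frob_norm (G t v) <= MD] w * \1_(A t) w) c.
  apply: (@bounded_has_mean _ _ _ _ _ 1).
    by apply: measurable_funM => //; exact: measurable_indic.
  move=> w; rewrite !indicE; case: (_ \in _); case: (_ \in _);
    by rewrite ?mul1r ?mul0r ?normr1 ?normr0 ?ler01.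
have tail : {ae P, forall w, A t w -> ((1 - delta)%:E <= Y1 w)%E}.
  by apply: filterS tailY1 => w H Aw; apply: H; exact: A_Delta.
have ac : (1 - delta) * a <= c.
  apply: (mean_good_ge (sF t) (FW t) (@mGW t) delta01 condY1 tail mk k01 _ ka
    kc).
  by move=> w Aw; rewrite indicE memNset.
have a1 : a <= 1.
  rewrite -lee_fin -ka.2 integral_indic// setIT; exact: probability_le1.
have [_ ec] := has_meanB ka kc.
rewrite -[P _]/(P (escape t)) -[escape t]setIT -integral_indic//;
  last exact: measurable_escape.
rewrite (_ : (fun w => _) = (fun w => (\1_(A t) w - \1_[set v | frob_norm (G t
  v) <= MD] w * \1_(A t) w)%:E)); last first.
  apply/funext => w; rewrite !indicE /escape in_setI.
  have -> : (w \in [set w | MD < frob_norm (G t w)]) = ~~ (w \in [set v |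
    frob_norm (G t v) <= MD]).
    by apply/idP/idP; rewrite ?inE ?notin_setE /= => h;
      [rewrite leNgt h|rewrite ltNge; apply/negP].
  case: (w \in A t); case: (_ \in _) => /=; congr (_%:E); lra.
rewrite ec lee_fin; have /andP[dl0 dl1] := delta01.
have : delta * a <= delta by rewrite -[leRHS]mulr1 ler_pM2l.
lra.
Qed.

(** The largest noise that [gap_rate] tolerates. *)
Let level t := mu * Delta0 * Num.sqrt N * Num.sqrt t%:R * (N + t%:R - 2) / 11.

Definition large_noise t : set W := [set w | level t <= \sum_(s < t) X s w].

Lemma measurable_large_noise t : measurable (large_noise t).
Proof.
have [sF FW FS] := Ffilt.
apply: measurable_set_bool; apply: measurable_fun_ler => //.
apply: measurable_sum => s.
exact: (measurable_wrtW (sF s.+1) (FW s.+1) (@mX s)).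
Qed.

(** Only positive times: [large_noise 0] compares [0] with an empty sum and is the whole space. *)
Lemma large_noise_prob t : (P (large_noise t.+1) <= delta%:E)%E.
Proof.
pose u := t.+1; rewrite -/u.
have u1 : 1 <= u%:R :> R by rewrite ler1n.
have u0 : 0 < u%:R :> R by rewrite ltr0n.
have n4 := N4; have Nu : 0 < N + u%:R - 2 by lra.
pose v : R := \sum_(s < u) (wt s * cG) ^+ 2.
have N0 : 0 < N by lra.
have v0 : 0 < v.
  rewrite /v /u big_ord_recl/= ltr_wpDr//.
    by apply: sumr_ge0 => s _; exact: sqr_ge0.
  by rewrite exprn_gt0// mulr_gt0// /wt addr0; lra.
(* For [s < u] the weight [N + s - 1] is at most [N + u - 2], the factor in [level u], so it cancels
   from the Azuma exponent. *)
have v_le : v <= u%:R * ((N + u%:R - 2) * cG) ^+ 2.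
  rewrite /v; apply: (@le_trans _ _ (\sum_(s < u) ((N + u%:R - 2) * cG) ^+ 2)).
    apply: ler_sum => s _; apply: lerXn2r; rewrite ?nnegrE.
    - by rewrite mulr_ge0// ltW.
    - by rewrite mulr_ge0// ltW.
    rewrite ler_pM2r// /wt.
    have : (s.+1)%:R <= u%:R :> R by rewrite ler_nat.
    by rewrite -natr1; lra.
  by rewrite sumr_const card_ord mulr_natl.
have l0 : 0 < level u.
  by rewrite divr_gt0// !mulr_gt0// sqrtr_gt0.
apply: le_trans (azuma_tail Ffilt mX X_le drift l0 v0) _.
have /andP[dl0 dl1] := delta01.
rewrite lee_fin -/v -[leRHS]lnK ?posrE// ler_expR lerNl -lnV ?posrE//.
rewrite ler_pdivlMr ?mulr_gt0//.
have ln0 : 0 <= ln delta^-1 by rewrite ln_ge0// invf_ge1// ltW.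
apply: (@le_trans _ _ (ln delta^-1 * (8 * (u%:R * ((N + u%:R - 2) * cG) ^+
  2)))).
  by rewrite ler_wpM2l// ler_wpM2l.
have key : 1024 * cG ^+ 2 * ln delta^-1 <= N * (mu ^+ 2 * Delta0 ^+ 2).
  have den0 : 0 < mu ^+ 2 * Delta0 ^+ 2 by rewrite mulr_gt0// exprn_gt0.
  move: Nln; rewrite div1r (ler_pdivrMr _ _ den0) /cG => h.
  apply: le_trans h; rewrite le_eqVlt; apply/orP; left; apply/eqP.
  by move: GD (ln _) => x y; ring.
have -> : level u ^+ 2 =
    (N * (mu ^+ 2 * Delta0 ^+ 2) / 121) * (u%:R * (N + u%:R - 2) ^+ 2).
  transitivity ((Num.sqrt N ^+ 2 * (mu ^+ 2 * Delta0 ^+ 2) / 121) *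
      (Num.sqrt u%:R ^+ 2 * (N + u%:R - 2) ^+ 2)).
    by rewrite /level; move: Delta0 (Num.sqrt N) (Num.sqrt _) => x y z; field.
  by rewrite !sqr_sqrtr ?ler0n// ltW.
have z0 : 0 <= u%:R * (N + u%:R - 2) ^+ 2 by rewrite mulr_ge0 ?sqr_ge0.
have lcz : 0 <= cG ^+ 2 * ln delta^-1 by rewrite mulr_ge0 ?sqr_ge0.
rewrite [leLHS](_ : _ =
  8 * (cG ^+ 2 * ln delta^-1) * (u%:R * (N + u%:R - 2) ^+ 2)); last first.
  by move: cG (ln _) => x y; ring.
by rewrite ler_wpM2r//; move: key lcz; rewrite -mulrA; move: (_ ^+ 2 * ln _) =>
  x; lra.
Qed.

(** The curvature term [LD/2 (eta_t MD)^2] of the descent step equals [kap / (N + t)^2]. *)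
Let kap := 2 * LD * MD ^+ 2 / mu ^+ 2.

Let kap_le : kap <= N * Delta0 / 4.
Proof.
move: NM; rewrite ler_pdivrMr ?mulr_gt0 ?exprn_gt0// => h.
rewrite /kap ler_pdivrMr ?exprn_gt0//; lra.
Qed.

(** A pathwise statement: off the bad events, strong induction keeps the earlier iterates in [A],
    where mask and truncation do nothing, so [drift_increment] describes the actual step. *)
Lemma gap_iterate_le w t :
  (forall s, (s < t)%N -> ~ escape s w) ->
  (forall s, (s < t)%N -> ~ large_noise s.+1 w) ->
  (gap f fstar (K t w) <=
   (q + 2 * Delta0 * Num.sqrt N / Num.sqrt (N + t%:R))%:E)%E.
Proof.
have n4 := N4; have N0 : 0 < N by lra.
have Nt t' : 0 < N + t'%:R by have := ler0n R t'; lra.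
elim/ltn_ind: t => t IH noesc nolarge.
have Aw s : (s < t)%N -> A s w.
  move=> st; apply: le_trans (IH s st _ _) _.
  - by move=> s' s's; apply: noesc; exact: ltn_trans st.
  - by move=> s' s's; apply: nolarge; exact: ltn_trans st.
  rewrite lee_fin (_ : 3 * Delta0 = Delta0 + 2 * Delta0); last by ring.
  apply: lerD => //; rewrite -mulrA -[leRHS]mulr1 ler_pM2l ?mulr_gt0//.
  rewrite ler_pdivrMr ?sqrtr_gt0// mul1r ler_wsqrtr//.
  by have := ler0n R s; lra.
have Gw s : (s < t)%N -> frob_norm (G s w) <= MD.
  move=> st; rewrite leNgt; apply/negP => h; apply: (noesc s st).
  by split => //; exact: Aw.
case: t => [|t] in IH noesc nolarge Aw Gw *.
  rewrite /K /= gapK0 lee_fin addr0 -mulrA mulfV ?gt_eqF ?sqrtr_gt0//.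
  by rewrite mulr1; have := Delta0_gt0; have := q_ge0; lra.
have step s : (s < t.+1)%N ->
    (gap f fstar (K s.+1 w) <= ((1 - 2 / (N + s%:R)) * fine (gap f fstar (K s
      w))
      + 2 / (mu * (N + s%:R)) * (mu * q + drift_increment (g s) (G s) bD VD MD
        delta w)
      + kap / (N + s%:R) ^+ 2)%:E)%E.
  move=> st.
  have eta0 : 0 < eta s by rewrite divr_gt0// mulr_gt0.
  have etaM : eta s * MD <= r Delta.
    rewrite /eta mulrAC ler_pdivrMr ?mulr_gt0// -/rD.
    move: Nr; rewrite ler_pdivrMr ?mulr_gt0// => h.
    have := mulr_ge0 (mulr_ge0 (ler0n R s) (ltW mu_gt0)) (ltW rD_gt0).
    by rewrite mulrDr; lra.
  have := gap_step_le f_ge land Delta_gt0 (A_lt (Aw s st)) (Gw s st) (ltW eta0)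
    etaM.
  move/le_trans; apply; rewrite lee_fin.
  have [lo _] := landscape_grad f_ge land Delta_gt0 (A_lt (Aw s st)).
  rewrite /drift_increment gE; last exact: Aw.
  rewrite indicE mem_set; last exact: (Gw s st).
  rewrite scale1r -/beta -/LD.
  (* The origin of [q]: on [A] the gradient is at most [gam <= GD], and [GD * beta = mu q]. *)
  have gb : beta * frob_norm (grad f (K s w)) <= mu * q.
    rewrite /q (mulrC mu) divfK ?gt_eqF// mulrC ler_wpM2r//.
    have := @g_le s w; rewrite gE; last exact: Aw.
    by move/le_trans; apply; have := GD_gt0; rewrite /gam; lra.
  have e1 : eta s * mu = 2 / (N + s%:R).
    by rewrite /eta; field; rewrite !gt_eqF.
  have e2 : LD / 2 * (eta s * MD) ^+ 2 = kap / (N + s%:R) ^+ 2.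
    by rewrite /eta /kap; field; rewrite !gt_eqF.
  rewrite e2 -e1 -/(eta s) lerD2r.
  (* Adding and subtracting [gn^2 - beta gn] exposes the increment; [mu * gap <= gn^2] then produces
     the contraction and [gb] the bias. *)
  set x := frob_inner _ _; set gn := frob_norm _ in lo gb *.
  have : eta s * (mu * fine (gap f fstar (K s w)) - x) <=
     eta s * (mu * q + (- x + gn ^+ 2 - beta * gn)).
    by rewrite ler_wpM2l ?(ltW eta0)//; lra.
  by lra.
have [_ gE' _ _] := gap_le_fin f_ge (step t (ltnSn t)).
rewrite gE' lee_fin.
have S_lt : \sum_(s < t.+1) wt s * drift_increment (g s) (G s) bD VD MD delta w
  <= level t.+1.
  by rewrite leNgt; apply/negP => /ltW; exact: nolarge.
apply: (gap_rate mu_gt0 N4 q_ge0 Delta0_gt0 kap_le S_lt).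
apply: (unroll_recursion (D := fun s => fine (gap f fstar (K s w)))
  (x := fun s => drift_increment (g s) (G s) bD VD MD delta w)) => //.
  by rewrite divr_ge0 ?sqr_ge0// !mulr_ge0 ?sqr_ge0// ltW.
move=> s st; rewrite -lee_fin.
by have [_ <- _ _] := gap_le_fin f_ge (step s st); exact: step.
Qed.

Lemma spg_high_probability T :
  ((1 - 2 * T%:R * delta)%:E <=
   P [set w | forall t : nat, (t <= T)%N ->
       (gap f fstar (K t w) <=
        (q + 3 * Delta0 * Num.sqrt N / Num.sqrt (N + t%:R))%:E)%E])%E.
Proof.
have [sF FW FS] := Ffilt.
set target := [set w | _].
(* Truncation can fail at times [0] to [T - 1], the noise sums at times [1] to [T]: [T] events of
   each kind. *)
pose bad1 := \big[setU/set0]_(s < T) escape s.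
pose bad2 := \big[setU/set0]_(s < T) large_noise s.+1.
have mbad1 : measurable bad1.
  by apply: bigsetU_measurable => s _; exact: measurable_escape.
have mbad2 : measurable bad2.
  by apply: bigsetU_measurable => s _; exact: measurable_large_noise.
have mtarget : measurable target.
  rewrite (_ : target = \bigcap_(t in [set t | (t <= T)%N]) [set w |
     (gap f fstar (K t w) <=
        (q + 3 * Delta0 * Num.sqrt N / Num.sqrt (N + t%:R))%:E)%E]); last first.
    by apply/seteqP; split.
  apply: bigcap_measurable; first by exists 0%N.
  move=> t _; rewrite -[X in measurable X]setTI.
  apply: emeasurable_fun_infty_c => //.
  exact: (measurable_wrtW (sF t) (FW t) (@gap_iterate_measurable t)).
have sub : ~` (bad1 `|` bad2) `<=` target.
  move=> w nbad t tT; apply: le_trans (gap_iterate_le _ _) _.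
  - move=> s st esc; apply: nbad; left.
    by rewrite /bad1 -bigcup_mkord; exists s => //=; exact: leq_trans st tT.
  - move=> s st esc; apply: nbad; right.
    rewrite /bad2 -(bigcup_mkord _ (fun s => large_noise s.+1)).
    by exists s => //=; exact: leq_trans st tT.
  - rewrite lee_fin lerD2l -!mulrA; have := ler0n R t => t0.
    rewrite [leLHS]mulrA [leRHS]mulrA.
    have : 0 <= Delta0 * (Num.sqrt N / Num.sqrt (N + t%:R)).
      by rewrite mulr_ge0 ?(ltW Delta0_gt0)// divr_ge0// sqrtr_ge0.
    by rewrite -!mulrA; lra.
have sumE (B : nat -> set W) : (forall s, measurable (B s)) ->
    (forall s, (P (B s) <= delta%:E)%E) ->
    (P (\big[setU/set0]_(s < T) B s) <= (T%:R * delta)%:E)%E.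
  move=> mB PB; apply: le_trans (Boole_inequality P (fun s _ => mB s)) _.
  apply: (@le_trans _ _ (\sum_(s < T) delta%:E)%E); first by apply: lee_sum =>
    s _; exact: PB.
  by rewrite sumEFin lee_fin sumr_const card_ord mulr_natl.
apply: (@le_trans _ _ (P (~` (bad1 `|` bad2)))); last first.
  apply: le_measure => //; rewrite inE//.
  by apply: measurableC; exact: measurableU.
rewrite probability_setC; last exact: measurableU.
rewrite EFinB leeB//.
apply: le_trans (measureU2 _ mbad1 mbad2) _.
rewrite (_ : 2 * T%:R * delta = T%:R * delta + T%:R * delta); last by ring.
rewrite EFinD leeD//.
  by apply: sumE; [exact: measurable_escape|exact: escape_prob].
by apply: (sumE (fun s => large_noise s.+1)) => s;
  [exact: measurable_large_noise|exact: large_noise_prob].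
Qed.

End SPG.

Theorem theorem3p1 (R : realType) (n m : nat)
    (A : 'M[R]_n) (B : 'M[R]_(n, m)) (Q : 'M[R]_n) (S : 'M[R]_m)
    (D : probability (borel_cV R n) R) (DX : R) (fstar : R)
    (mu : R) (L r : R -> R)
    (d : measure_display) (W : measurableType d) (P : probability W R)
    (F : nat -> set (set W)) (G : nat -> W -> 'M[R]_(m, n))
    (b : R -> R -> R) (V : R -> R) (M : R -> R -> R)
    (K0 : 'M[R]_(m, n)) (T : nat) (delta : R) :
  sym_posdef Q -> sym_posdef S ->
  0 < DX -> initial_distribution D DX ->
  let f := lqr_cost A B Q S D in
  is_minimum f fstar ->
  landscape_constants f (stable A B) fstar mu L r ->
  filtration F ->
  (forall t, measurable_mx_wrt (F t.+1) (G t)) ->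
  (1 <= T)%N -> 0 < delta < 1 ->
  stable A B K0 -> (0 < gap f fstar K0)%E ->
  let Delta0 := fine (gap f fstar K0) in
  let Delta := 4 * Delta0 in
  let LD := L Delta in
  let rD := r Delta in
  let bD := b Delta delta in
  let VD := V Delta in
  let MD := M Delta delta in
  let GD := 2 * Num.sqrt (LD * Delta) in
  let N : R := (Num.ceil
    (Num.max 4
    (Num.max (2 * MD / (mu * rD))
    (Num.max (1024 * GD ^+ 2 * (MD + GD) ^+ 2 * ln (1 / delta)
                / (mu ^+ 2 * Delta0 ^+ 2))
             (8 * LD * MD ^+ 2 / (mu ^+ 2 * Delta0))))))%:~R in
  let C := 3 * Delta0 * Num.sqrt N in
  let eta t := 2 / (mu * (N + t%:R)) in
  let K := spg_iterates K0 eta G in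
  noise_condition P f fstar F K G b V M ->
  GD * (bD + Num.sqrt (VD * delta)) / mu <= Delta0 ->
  ((1 - 2 * T%:R * delta)%:E <=
   P [set w | forall t : nat, (t <= T)%N ->
       (gap f fstar (K t w) <=
        (GD * (bD + Num.sqrt (VD * delta)) / mu
         + C / Num.sqrt (N + t%:R))%:E)%E])%E.
Proof.
move=> Qpd Spd DX0 init f [_ f_ge] land Ffilt mG T1 delta01 K0stable K0pos.
move=> Delta0 Delta LD rD bD VD MD GD N C eta K noise q_le.
(* Stability of [K0] makes [Delta0] the true gap, as [fine] sends [+oo] to [0]. *)
have K0fin : (gap f fstar K0 < +oo)%E.
  have := stable_lqr_cost_lt_pinfty Qpd Spd init K0stable.
  rewrite /gap -/f; have := f_ge K0; case: (f K0) => //= x _ _.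
  by rewrite -EFinB ltry.
have NE : forall x, x <= Num.max 4
    (Num.max (2 * MD / (mu * rD))
    (Num.max (1024 * GD ^+ 2 * (MD + GD) ^+ 2 * ln (1 / delta)
                / (mu ^+ 2 * Delta0 ^+ 2))
             (8 * LD * MD ^+ 2 / (mu ^+ 2 * Delta0)))) -> x <= N.
  by move=> x /le_trans; apply; exact: ceil_ge.
apply: (spg_high_probability _ f_ge land Ffilt mG delta01 K0fin K0pos
  _ _ _ _ noise q_le T).
- by move=> d' T' X; exact: measurable_lqr_cost.
- by apply: NE; rewrite le_max lexx.
- by apply: NE; rewrite !le_max lexx !orbT.
- by apply: NE; rewrite !le_max lexx !orbT.
- by apply: NE; rewrite !le_max lexx !orbT.
Qed.
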